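(* Let $\{A(t,\varphi): t\in\mathbb R,\varphi\in E\}$ be a family of m-dissipative operators in $X$, and suppose that either (i) $A$ satisfies the uniformly continuous control condition with data $(h,k,K_0,L_1,L_2)$ and $K_0<-\omega$, or (ii) $A$ satisfies the Lipschitz control condition with data $(g,h,k,K_0,L_1,L_2)$ and $\max\{K_0,L_g\}<-\omega$, where $L_g$ is the Lipschitz constant of $g$. Let $\psi\in BUC(\mathbb R,X)$ and let $\{u_{n,\lambda}\}_{n\ge 1,\lambda>0}$ be the double sequence defined by the recursion started at $\psi$. Then: (1) the double sequence converges uniformly on $\mathbb R$, in the sense that for each $n\ge1$ the limit $u_n=\lim_{\lambda\to0+}u_{n,\lambda}$ exists uniformly on $\mathbb R$, and $u=\lim_{n\to\infty}u_n$ exists uniformly on $\mathbb R$; (2) the limit $u$ does not depend on the starting point $\psi\in BUC(\mathbb R,X)$; (3) with $B(t):=A(t,u_t)$, $t\in\mathbb R$, the function $u$ is an integral solution on $\mathbb R$ of $v'(t)\in B(t)v(t)+\omega v(t)$, $t\in\mathbb R$, with respect to suitable control functions $h_B,L_B$ and $g$ (with $g=0$ in case (i)); that is, there exist a Banach space $Z$, a bounded uniformly continuous $h_B:\mathbb R\to Z$ and a continuous non-decreasing $L_B:\mathbb R^+\to\mathbb R^+$ such that $u$ is an integral solution with respect to $(h_B,L_B,g)$.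
   Context: $X$ is a Banach space, $\omega\in\mathbb R$, $\mathbb R^+=[0,\infty)$. $BUC(J,X)$ denotes the bounded uniformly continuous functions $J\to X$ with the sup norm. Either (infinite delay) $\mathbb I=(-\infty,0]$ and $E=BUC((-\infty,0],X)$, or (finite delay) $\mathbb I=[-r,0]$ for some $r>0$ and $E=C([-r,0],X)$; $E$ carries the sup norm $\|\cdot\|_E$. For $u\in BUC(\mathbb R,X)$ and $t\in\mathbb R$, $u_t\in E$ is $u_t(s)=u(t+s)$, $s\in\mathbb I$. The operators $A(t,\varphi)\subset X\times X$ may be multivalued, with domain depending on $(t,\varphi)$; m-dissipative means dissipative with $R(I-\lambda A(t,\varphi))=X$ for all $\lambda>0$. The functional differential equation under study is $u'(t)\in A(t,u_t)u(t)+\omega u(t)$, $t\in\mathbb R$; the limit $u$ is called its solution. Uniformly continuous control condition with data $(h,k,K_0,L_1,L_2)$: $h,k:\mathbb R\to X$ are bounded and uniformly continuous, $K_0>0$, $L_1,L_2:\mathbb R^+\to\mathbb R^+$ are continuous and non-decreasing, and for all $\lambda>0$, $t_1,t_2\in\mathbb R$, $\varphi_1,\varphi_2\in E$, $[x_i,y_i]\in A(t_i,\varphi_i)$ ($i=1,2$), $$\|x_1-x_2\|\le\|x_1-x_2-\lambda(y_1-y_2)\|+\lambda\|h(t_1)-h(t_2)\|L_1(\|x_2\|)+\lambda\|k(t_1)-k(t_2)\|L_2(\|\varphi_2\|_E)+K_0\lambda\|\varphi_1-\varphi_2\|_E.$$ Lipschitz control condition with data $(g,h,k,K_0,L_1,L_2)$: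 $g,h,k:\mathbb R\to X$ are bounded and Lipschitz continuous, $K_0>0$, $L_1,L_2:\mathbb R^+\to\mathbb R^+$ are continuous and non-decreasing, and for all $\lambda>0$, $t_1,t_2\in\mathbb R$, $\varphi_1,\varphi_2\in E$, $[x_i,y_i]\in A(t_i,\varphi_i)$ ($i=1,2$), $$\|x_1-x_2\|\le\|x_1-x_2-\lambda(y_1-y_2)\|+\lambda\|h(t_1)-h(t_2)\|L_1(\|x_2\|)+\lambda\|g(t_1)-g(t_2)\|\,\|y_2\|+\lambda\|k(t_1)-k(t_2)\|L_2(\|\varphi_2\|_E)+K_0\lambda\|\varphi_1-\varphi_2\|_E.$$ Yosida approximation of the derivative: for $\lambda>0$ and $u\in BUC(\mathbb R,X)$, $(\partial_t)_\lambda u(t)=\frac1\lambda\Big(u(t)-\frac1\lambda\int_0^\infty e^{-\tau/\lambda}u(t-\tau)\,d\tau\Big)$. Recursion started at $\psi\in BUC(\mathbb R,X)$: for $\lambda>0$, $u_{1,\lambda}\in BUC(\mathbb R,X)$ is the (unique) solution of $(\partial_t)_\lambda u_{1,\lambda}(t)\in A(t,\psi_t)u_{1,\lambda}(t)+\omega u_{1,\lambda}(t)$, $t\in\mathbb R$; given $u_{n,\lambda}$, $u_{n+1,\lambda}\in BUC(\mathbb R,X)$ is the (unique) solution of $(\partial_t)_\lambda u_{n+1,\lambda}(t)\in A(t,(u_{n,\lambda})_t)u_{n+1,\lambda}(t)+\omega u_{n+1,\lambda}(t)$, $t\in\mathbb R$. Integral solution: let $\{B(t):t\in\mathbb R\}$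 be operators in $X$, let $Z$ be a Banach space, $h_B:\mathbb R\to Z$ bounded and uniformly continuous, $L_B:\mathbb R^+\to\mathbb R^+$ continuous non-decreasing, $g:\mathbb R\to X$ bounded and Lipschitz, such that for all $\lambda>0$, $t_1,t_2\in\mathbb R$, $[x_i,y_i]\in B(t_i)$: $\|x_1-x_2\|\le\|x_1-x_2-\lambda(y_1-y_2)\|+\lambda\|h_B(t_1)-h_B(t_2)\|L_B(\|x_2\|)+\lambda\|g(t_1)-g(t_2)\|\|y_2\|$. Put $h_B^\omega(t)=(h_B(t),|\omega|g(t))\in Z\times X$ (with norm $\|(a,b)\|_1=\|a\|+\|b\|$) and $L_B^\omega(s)=L_B(s)+s$. A continuous $u:\mathbb R\to X$ is an integral solution on $\mathbb R$ of $v'(t)\in B(t)v(t)+\omega v(t)$ with respect to $(h_B,L_B,g)$ if $$\|u(t)-x\|-\|u(r)-x\|\le\int_r^t\big([y,u(\nu)-x]_++\omega\|u(\nu)-x\|\big)d\nu+L_B^\omega(\|x\|)\int_r^t\|h_B^\omega(\nu)-h_B^\omega(r)\|d\nu+\|y\|\int_r^t\|g(\nu)-g(r)\|d\nu$$ for all $-\infty<r\le t<\infty$ and all $[x,y]\in B(r)+\omega I$. Here $[y,x]_+=\lim_{\alpha\to0+}\alpha^{-1}(\|x+\alpha y\|-\|x\|)$. *)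

(* Defs.v *)
From HB Require Import structures.
From mathcomp Require Import all_boot all_order all_algebra.
From mathcomp Require Import all_classical all_reals all_analysis.

Set Implicit Arguments.
Unset Strict Implicit.
Unset Printing Implicit Defensive.
Import Order.TTheory GRing.Theory Num.Theory.
Import numFieldNormedType.Exports.
Local Open Scope classical_set_scope.
Local Open Scope ring_scope.

Definition bounded_unif_continuous (R : realType) (X : normedModType R)
    (T : uniformType) (f : T -> X) : Prop :=
  bounded_fun f /\ unif_continuous f.

Definition bounded_lipschitz (R : realType) (X : normedModType R)
    (f : R -> X) : Prop :=
  bounded_fun f /\ lipschitz f.

Definition lipschitz_constant (R : realType) (X : normedModType R)
    (f : R -> X) : R :=
  inf [set k : R | 0 <= k /\ k.-lipschitz f].

Record BUC (R : realType) (X : normedModType R) := MkBUC {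
  BUC_fun :> R -> X;
  BUC_funP : bounded_unif_continuous BUC_fun }.

Variant delay (R : realType) : Type :=
  | InfiniteDelay
  | FiniteDelay of {posnum R}.

Definition delay_itv (R : realType) (d : delay R) : set R :=
  match d with
  | InfiniteDelay => [set` `]-oo, 0]]
  | FiniteDelay r => [set` `[- r%:num, 0]]
  end.

Definition is_history (R : realType) (X : normedModType R) (d : delay R)
    (phi : delay_itv d -> X) : Prop :=
  match d return (delay_itv d -> X) -> Prop with
  | InfiniteDelay => fun f => bounded_unif_continuous f
  | FiniteDelay _ => fun f => continuous f
  end phi.

(* The space E: BUC((-oo, 0], X) for the infinite delay and C([-r, 0], X) for
   the finite delay r.  Its elements are functions on the delay interval, seen
   as a type with its subspace uniformity. *)
Record history (R : realType) (X : normedModType R) (d : delay R) :=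
  MkHistory {
    history_fun :> delay_itv d -> X;
    historyP : is_history history_fun }.

Definition sup_norm (R : realType) (X : normedModType R) (T : Type)
    (f : T -> X) : R :=
  sup (range (fun s => `|f s|)).

Lemma segment_subproof (R : realType) (X : normedModType R) (d : delay R)
    (u : BUC X) (t : R) :
  is_history (fun s : delay_itv d => u (t + \val s)).
Proof.
have Huc (D : set R) : unif_continuous (fun s : D => u (t + \val s)).
  apply/unif_continuousP => e e0.
  have /unif_continuousP /(_ e e0) [r /= r0 Hr] := (BUC_funP u).2.
  exists r => //= -[a b] /= ab.
  apply: (Hr (t + \val a, t + \val b)) => /=.
  rewrite -ball_normE /ball_ /= opprD addrACA subrr add0r.
  by rewrite -[ball a r b]/(ball (set_val a) r (set_val b)) in ab;
     rewrite -ball_normE in ab.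
case: d => [|r] /=.
  split; last exact: Huc.
  have [M [Mr HM]] := (BUC_funP u).1.
  by exists M; split => // x /HM + y _ => /(_ (t + \val y) I).
move=> x B /nbhs_ballP[e /= e0 eB].
have /unif_continuousP /(_ e e0) [r' /= r0 Hr] := Huc (delay_itv (FiniteDelay r)).
apply/nbhs_ballP; exists r' => //= y xy; apply: eB; exact: (Hr (x, y)).
Qed.

(* u_t, i.e. s |-> u (t + s) on the delay interval *)
Definition segment (R : realType) (X : normedModType R) (d : delay R)
    (u : BUC X) (t : R) : history X d :=
  MkHistory (@segment_subproof R X d u t).
Arguments segment {R X d} u t.

(* A multivalued operator in X is its graph, a set of pairs [x, y]. *)
Definition m_dissipative (R : realType) (X : normedModType R)
    (A : set (X * X)) : Prop :=
  (forall (lambda : R) (x1 y1 x2 y2 : X), 0 < lambda ->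
     A (x1, y1) -> A (x2, y2) ->
     `|x1 - x2| <= `|x1 - x2 - lambda *: (y1 - y2)|) /\
  (forall lambda : R, 0 < lambda ->
     forall z : X, exists x y : X, A (x, y) /\ z = x - lambda *: y).

(* L : [0, +oo) -> [0, +oo) continuous and non-decreasing; the values of L
   outside [0, +oo) are irrelevant. *)
Definition control_modulus (R : realType) (L : R -> R) : Prop :=
  [/\ forall s : R, 0 <= s -> 0 <= L s,
      {within [set` `[0, +oo[], continuous L} &
      forall s t : R, 0 <= s -> s <= t -> L s <= L t].

Definition unif_control (R : realType) (X : normedModType R) (d : delay R)
    (A : R -> history X d -> set (X * X))
    (h k : R -> X) (K0 : R) (L1 L2 : R -> R) : Prop :=
  [/\ bounded_unif_continuous h /\ bounded_unif_continuous k,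
      0 < K0,
      control_modulus L1 /\ control_modulus L2 &
      forall (lambda t1 t2 : R) (phi1 phi2 : history X d) (x1 y1 x2 y2 : X),
        0 < lambda -> A t1 phi1 (x1, y1) -> A t2 phi2 (x2, y2) ->
        `|x1 - x2| <= `|x1 - x2 - lambda *: (y1 - y2)|
          + lambda * `|h t1 - h t2| * L1 `|x2|
          + lambda * `|k t1 - k t2| * L2 (sup_norm phi2)
          + K0 * lambda * sup_norm (fun s => phi1 s - phi2 s)].

Definition lipschitz_control (R : realType) (X : normedModType R)
    (d : delay R) (A : R -> history X d -> set (X * X))
    (g h k : R -> X) (K0 : R) (L1 L2 : R -> R) : Prop :=
  [/\ [/\ bounded_lipschitz g, bounded_lipschitz h & bounded_lipschitz k],
      0 < K0,
      control_modulus L1 /\ control_modulus L2 &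
      forall (lambda t1 t2 : R) (phi1 phi2 : history X d) (x1 y1 x2 y2 : X),
        0 < lambda -> A t1 phi1 (x1, y1) -> A t2 phi2 (x2, y2) ->
        `|x1 - x2| <= `|x1 - x2 - lambda *: (y1 - y2)|
          + lambda * `|h t1 - h t2| * L1 `|x2|
          + lambda * `|g t1 - g t2| * `|y2|
          + lambda * `|k t1 - k t2| * L2 (sup_norm phi2)
          + K0 * lambda * sup_norm (fun s => phi1 s - phi2 s)].

(* Riemann integral of vector-valued functions, as the limit of the Riemann
   sums over tagged partitions when the mesh tends to 0: the partition is
   a :: s and xi i is the tag of its i-th subinterval. *)
Definition riemann_sum (R : realType) (X : normedModType R) (f : R -> X)
    (a : R) (s : seq R) (xi : nat -> R) : X :=
  \sum_(i < size s) (s`_i - (a :: s)`_i) *: f (xi i).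

Definition is_riemann_integral (R : realType) (X : normedModType R)
    (f : R -> X) (a b : R) (I : X) : Prop :=
  forall eps : R, 0 < eps -> exists2 delta : R, 0 < delta &
    forall (s : seq R) (xi : nat -> R), itv_partition a b s ->
      (forall i, (i < size s)%N ->
         s`_i - (a :: s)`_i < delta /\ (a :: s)`_i <= xi i <= s`_i) ->
      `|riemann_sum f a s xi - I| < eps.

Definition is_improper_integral (R : realType) (X : normedModType R)
    (f : R -> X) (a : R) (I : X) : Prop :=
  exists F : R -> X,
    (forall b : R, a <= b -> is_riemann_integral f a b (F b)) /\
    F b @[b --> +oo] --> I.

(* The integral of f over [a, +oo), and 0 if it does not exist.  The library
   has no Bochner integral; this one agrees with it on the continuous,
   absolutely integrable functions to which it is applied below. *)
Definition improper_integral (R : realType) (X : normedModType R)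
    (f : R -> X) (a : R) : X :=
  xget 0 [set I | is_improper_integral f a I].

Definition yosida_derivative (R : realType) (X : normedModType R)
    (lambda : R) (u : R -> X) (t : R) : X :=
  lambda^-1 *: (u t - lambda^-1 *:
    improper_integral (fun tau => expR (- tau / lambda) *: u (t - tau)) 0).

(* v solves (d/dt)_lambda v(t) \in A(t, phi_t) v(t) + omega v(t), t \in R. *)
Definition approx_solution (R : realType) (X : normedModType R) (d : delay R)
    (A : R -> history X d -> set (X * X)) (omega lambda : R)
    (phi v : BUC X) : Prop :=
  forall t : R, exists y : X,
    A t (segment phi t) (v t, y) /\
    yosida_derivative lambda v t = y + omega *: v t.

(* uu n lambda is u_{n, lambda}, for n >= 1 and lambda > 0; the other values
   of uu are irrelevant. *)
Definition recursion (R : realType) (X : normedModType R) (d : delay R)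
    (A : R -> history X d -> set (X * X)) (omega : R)
    (psi : BUC X) (uu : nat -> R -> BUC X) : Prop :=
  forall lambda : R, 0 < lambda ->
    approx_solution A omega lambda psi (uu 1%N lambda) /\
    forall n : nat, (1 <= n)%N ->
      approx_solution A omega lambda (uu n lambda) (uu n.+1 lambda).

(* u = lim_{n -> oo} lim_{lambda -> 0+} u_{n, lambda}, both limits being
   uniform on R *)
Definition uniform_double_limit (R : realType) (X : normedModType R)
    (uu : nat -> R -> BUC X) (u : R -> X) : Prop :=
  exists un : nat -> R -> X,
    (forall n : nat, (1 <= n)%N ->
       {uniform, (fun lambda : R => uu n lambda : R -> X) @ 0^'+ --> un n}) /\
    {uniform, un @ \oo --> u}.

(* [y, x]_+ *)
Definition bracket_plus (R : realType) (X : normedModType R) (y x : X) : R :=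
  lim ((fun alpha : R => alpha^-1 * (`|x + alpha *: y| - `|x|)) @ 0^'+).

Definition shift_operator (R : realType) (X : normedModType R)
    (B : set (X * X)) (omega : R) : set (X * X) :=
  [set p | exists y : X, B (p.1, y) /\ p.2 = y + omega *: p.1].

Definition norm1 (R : realType) (Z X : normedModType R) (p : Z * X) : R :=
  `|p.1| + `|p.2|.

Definition operator_control (R : realType) (X Z : normedModType R)
    (B : R -> set (X * X)) (hB : R -> Z) (LB : R -> R) (g : R -> X) : Prop :=
  [/\ bounded_unif_continuous hB,
      control_modulus LB,
      bounded_lipschitz g &
      forall (lambda t1 t2 : R) (x1 y1 x2 y2 : X),
        0 < lambda -> B t1 (x1, y1) -> B t2 (x2, y2) ->
        `|x1 - x2| <= `|x1 - x2 - lambda *: (y1 - y2)|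
          + lambda * `|hB t1 - hB t2| * LB `|x2|
          + lambda * `|g t1 - g t2| * `|y2|].

Definition integral_solution (R : realType) (X Z : normedModType R)
    (B : R -> set (X * X)) (omega : R)
    (hB : R -> Z) (LB : R -> R) (g : R -> X) (u : R -> X) : Prop :=
  let mu := @lebesgue_measure R in
  let hBw := fun t : R => (hB t, `|omega| *: g t) in
  let LBw := fun s : R => LB s + s in
  [/\ operator_control B hB LB g,
      continuous u &
      forall (r t : R) (x y : X), r <= t ->
        shift_operator (B r) omega (x, y) ->
        `|u t - x| - `|u r - x| <=
          \int[mu]_(nu in `[r, t])
             (bracket_plus y (u nu - x) + omega * `|u nu - x|)
          + LBw `|x| * \int[mu]_(nu in `[r, t]) norm1 (hBw nu - hBw r)
          + `|y| * \int[mu]_(nu in `[r, t]) `|g nu - g r|].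

(* Main.v *)
Require Import Defs.
From HB Require Import structures.
From mathcomp Require Import all_boot all_order all_algebra.
From mathcomp Require Import all_classical all_reals all_analysis.
From mathcomp Require Import ring lra.

Set Implicit Arguments.
Unset Strict Implicit.
Unset Printing Implicit Defensive.
Import Order.TTheory GRing.Theory Num.Theory.
Import numFieldNormedType.Exports.
Local Open Scope classical_set_scope.
Local Open Scope ring_scope.

(* With J_l = (1 + l d/dt)^-1 the Yosida derivative is (1 - J_l) / l, so u is an
   approximate solution for the history phi iff it is a fixed point of the
   resolvent of A(t, phi_t) applied to J_l u / (1 - l omega); this map is a
   contraction because omega < 0.  For fixed phi the approximate solutions are
   Cauchy as l -> 0+ by Kobayashi's doubling of variables, first for the phi
   along which the g-term of the control condition is Lipschitz in t - s, then
   for all phi because the solution depends on phi with Lipschitz constant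
   K0 / -omega, uniformly in l.  The limit phi |-> S phi has the same constant,
   which is < 1, so its iterates converge to its unique fixed point u.  For the
   integral inequality, Z is the space of bounded functions with values in X and
   h_B collects h, k and the translates u(t + .); the increments of J_l v over
   short intervals are estimated for the approximate solutions v -> u, and
   summed. *)

(** Both thresholds come from one cancellation. After the shift by [omega], the control condition
    with step [a] has the factor [1 - a * omega] on the left, while every error term on the right
    carries a factor [a]. When the remaining norm is at most the supremum being estimated, [a]
    cancels and the errors are divided by [- omega], whatever [lambda] is. Hence the ratios
    [K0 / - omega] for the dependence on the history and [Lg / - omega] for the g-term. The obstacle
    is the norm of [y2] in the g-term: along an approximate solution it involves a Yosida
    derivative, a priori of size [1 / lambda]. Lipschitz data give a bound uniform in [lambda], and
    a general history is reached from Lipschitz ones by density. In the integral inequality the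
    bracket, an infimum of difference quotients, need not be continuous in its second argument. A
    quotient of fixed step is Lipschitz, so [lambda] goes to 0 with the step frozen, and the step
    goes to 0 afterwards. *)

(** * Identities between linear combinations of vectors *)

Section linear_combinations.
Variables (R : comNzRingType) (X : lmodType R).

Inductive lincomb :=
  | LVar of nat | LZero | LAdd of lincomb & lincomb | LOpp of lincomb
  | LScale of R & lincomb.

Fixpoint lincomb_eval (env : seq X) (e : lincomb) : X :=
  match e with
  | LVar i => env`_i
  | LZero => 0
  | LAdd e1 e2 => lincomb_eval env e1 + lincomb_eval env e2
  | LOpp e1 => - lincomb_eval env e1
  | LScale c e1 => c *: lincomb_eval env e1
  end.

Fixpoint lincomb_coef (e : lincomb) (i : nat) : R :=
  match e with
  | LVar j => if (i == j)%N then 1 else 0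
  | LZero => 0
  | LAdd e1 e2 => lincomb_coef e1 i + lincomb_coef e2 i
  | LOpp e1 => - lincomb_coef e1 i
  | LScale c e1 => c * lincomb_coef e1 i
  end.

Lemma lincomb_evalE env e :
  lincomb_eval env e = \sum_(i < size env) lincomb_coef e i *: env`_i.
Proof.
elim: e => [j||e1 IH1 e2 IH2|e1 IH|c e1 IH] /=.
- have [jn|nj] := ltnP j (size env).
    rewrite (bigD1 (Ordinal jn))//= eqxx scale1r big1 ?addr0// => i ij.
    by rewrite ifN ?scale0r//; apply: contraNneq ij => ij; apply/eqP/val_inj.
  rewrite nth_default// big1// => i _; rewrite ifN ?scale0r//.
  by rewrite neq_ltn (leq_trans (ltn_ord i) nj).
- by rewrite big1// => i _; rewrite scale0r.
- by rewrite IH1 IH2 -big_split/=; apply: eq_bigr => i _; rewrite scalerDl.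
- by rewrite IH -sumrN; apply: eq_bigr => i _; rewrite scaleNr.
- by rewrite IH scaler_sumr; apply: eq_bigr => i _; rewrite scalerA.
Qed.

(** A conjunction that computes: a concrete goal unfolds into one scalar equation per vector, ready
    for [ring] or [field]. *)
Fixpoint lincomb_eqs (n : nat) (e1 e2 : lincomb) : Prop :=
  match n with
  | 0%N => True
  | n'.+1 => lincomb_coef e1 n' = lincomb_coef e2 n' /\ lincomb_eqs n' e1 e2
  end.

Lemma lincomb_eq env e1 e2 : lincomb_eqs (size env) e1 e2 ->
  lincomb_eval env e1 = lincomb_eval env e2.
Proof.
rewrite !lincomb_evalE => H; apply: eq_bigr => -[i] /= ilt _; congr (_ *: _).
elim: (size env) H ilt => // n IH [Hn /IH{}IH]; rewrite ltnS leq_eqVlt.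
by move=> /predU1P[->|].
Qed.

End linear_combinations.

Ltac lin_add_atom x l :=
  lazymatch l with
  | context [cons x _] => l
  | _ => constr:(cons x l)
  end.

Ltac lin_atoms l t :=
  lazymatch t with
  | (?a + ?b)%R => let l' := lin_atoms l a in lin_atoms l' b
  | (- ?a)%R => lin_atoms l a
  | (?c *: ?a)%R => lin_atoms l a
  | 0%R => l
  | ?x => lin_add_atom x l
  end.

Ltac lin_index x l :=
  lazymatch l with
  | cons x _ => constr:(0%N)
  | cons _ ?l' => let n := lin_index x l' in constr:(S n)
  end.

Ltac lin_reify R l t :=
  lazymatch t with
  | (?a + ?b)%R =>
      let a' := lin_reify R l a in let b' := lin_reify R l b in
      constr:(@LAdd R a' b')
  | (- ?a)%R => let a' := lin_reify R l a in constr:(@LOpp R a')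
  | (?c *: ?a)%R => let a' := lin_reify R l a in constr:(@LScale R c a')
  | 0%R => constr:(@LZero R)
  | ?x => let n := lin_index x l in constr:(@LVar R n)
  end.

(* Reduces an identity between linear combinations of vectors to the equality
   of the scalar coefficients. *)
Ltac lin_eq R :=
  lazymatch goal with
  | |- @eq ?X ?a ?b =>
    let l0 := lin_atoms (@nil X) a in
    let l := lin_atoms l0 b in
    let a' := lin_reify R l a in
    let b' := lin_reify R l b in
    apply: (@lincomb_eq R _ l a' b'); do ?split => //=
  end.

Ltac lin R := lin_eq R; try ring.

(** * Chaining of local estimates and Cauchy limits *)

(** Repeated bisection brings the length below [delta], so a relation that is additive over adjacent
    intervals only needs checking on short ones. *)
Lemma interval_chain (R : realType) (P : R -> R -> Prop) (a delta : R) :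
    0 < delta ->
    (forall x z y : R, a <= x -> x <= z -> z <= y -> P x z -> P z y -> P x y) ->
    (forall x y : R, a <= x -> x <= y -> y - x < delta -> P x y) ->
  forall x y : R, a <= x -> x <= y -> P x y.
Proof.
move=> d0 Ptrans Ploc x y ax xy.
have [n] : exists n : nat, y - x < delta * 2 ^+ n.
  exists (Num.bound ((y - x) / delta)).
  by rewrite mulrC -ltr_pdivrMr//; exact: upper_nthrootP.
elim: n x y ax xy => [|n IH] x y ax xy; first by rewrite expr0 mulr1; exact: Ploc.
rewrite exprS => h.
have xm : x <= (x + y) / 2 by lra.
have my : (x + y) / 2 <= y by lra.
apply: (Ptrans _ ((x + y) / 2)) => //; apply: IH => //; lra.
Qed.

Lemma small_inv (R : realType) (e : R) : 0 < e ->
  exists N, forall n, (N <= n)%N -> n.+1%:R^-1 < e.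
Proof.
move=> e0; exists (Num.bound e^-1) => n Nn.
rewrite invf_plt ?posrE//.
have e10 : 0 <= e^-1 by rewrite invr_ge0 ltW.
by apply: lt_le_trans (archi_boundP e10) _; rewrite ler_nat leqW.
Qed.

Lemma seq_cauchy_cvg (R : realType) (X : completeNormedModType R)
    (u : nat -> X) :
    (forall e : R, 0 < e -> exists N, forall m n, (N <= m)%N -> (N <= n)%N ->
       `|u m - u n| <= e) ->
  cvg (u @ \oo).
Proof.
move=> Hu; apply/cauchy_cvgP/cauchy_ballP => e e0.
have [|N HN] := Hu (e / 2); first lra.
near_simpl; exists ([set n | N <= n], [set n | N <= n])%N; first by split; exists N.
move=> [m n] [/= Nm Nn]; rewrite -ball_normE /ball_ /=.
by apply: le_lt_trans (HN _ _ Nm Nn) _; lra.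
Qed.

Lemma lim_norm_le (R : realType) (X : normedModType R) (T : Type)
    (F : set_system T) {FF : ProperFilter F} (f : T -> X) (l c : X) (b : R) :
  f @ F --> l -> (\forall x \near F, `|f x - c| <= b) -> `|l - c| <= b.
Proof.
move=> fl fb; apply: cvgr_to_le fb.
by apply: cvg_norm; apply: cvgB => //; exact: cvg_cst.
Qed.

(* F is a primitive of f on [0, +oo[ whose difference quotients converge
   uniformly; this is what Riemann sums need, and it passes to limits without
   any differentiability theory for vector-valued functions. *)
Definition unif_primitive (R : realType) (X : normedModType R) (f F : R -> X) :=
  forall e : R, 0 < e -> exists2 delta : R, 0 < delta &
    forall x xi y : R, 0 <= x -> x <= xi -> xi <= y -> y - x < delta ->
      `|F y - F x - (y - x) *: f xi| <= e * (y - x).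

Lemma unif_primitiveB (R : realType) (X : normedModType R) (f f' F F' : R -> X) :
    unif_primitive f F -> unif_primitive f' F' ->
  unif_primitive (f \- f') (F \- F').
Proof.
move=> HF HF' e e0.
have [|d d0 Hd] := HF (e / 2); first lra.
have [|d' d'0 Hd'] := HF' (e / 2); first lra.
exists (Num.min d d'); first by rewrite lt_min d0.
move=> x xi y x0 xxi xiy; rewrite lt_min => /andP[xyd xyd'].
have := Hd _ _ _ x0 xxi xiy xyd; have := Hd' _ _ _ x0 xxi xiy xyd'.
rewrite /= scalerBr => h1 h2.
have -> : F y - F' y - (F x - F' x) - ((y - x) *: f xi - (y - x) *: f' xi) =
  (F y - F x - (y - x) *: f xi) - (F' y - F' x - (y - x) *: f' xi) by lin R.
by apply: le_trans (ler_normB _ _) _; lra.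
Qed.

(** * Primitives of vector-valued functions as limits of step primitives *)

Section primitive_existence.
Variables (R : realType) (X : completeNormedModType R) (f : R -> X).

(** For [d > 0], the length of the part of the cell from [i * d] to [(i + 1) * d] that lies to the
    left of [x] and in [[0, +oo)]. *)
Let clip (d : R) (i : nat) (x : R) : R :=
  Num.max 0 (Num.min d (x - i%:R * d)).

Let clip_sum d n x : 0 < d -> 0 <= x ->
  \sum_(i < n) clip d i x = Num.min x (n%:R * d).
Proof.
move=> d0 x0; elim: n => [|n IH].
  by rewrite big_ord0 mul0r (min_idPr _).
rewrite big_ord_recr /= IH /clip [n.+1%:R]mulrS mulrDl mul1r.
set c := n%:R * d.
rewrite /Num.max /Num.min; repeat case: ifPn => //; rewrite -?leNgt; lra.
Qed.

Let clip_mono d i x y : x <= y -> clip d i x <= clip d i y.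
Proof.
move=> xy; rewrite /clip.
rewrite /Num.max /Num.min; repeat case: ifPn => //; rewrite -?leNgt; lra.
Qed.

(** The integral over [[0, x]] of the step function equal to [f (i * d)] on the [i]-th of [n]
    cells. *)
Let step_prim d n x : X := \sum_(i < n) clip d i x *: f (i%:R * d).

Let step_prim_widen d m n x : 0 < d -> (m <= n)%N -> x <= m%:R * d ->
  step_prim d n x = step_prim d m x.
Proof.
move=> d0 mn xm; rewrite /step_prim -(subnKC mn) big_split_ord/=.
rewrite [X in _ + X]big1 ?addr0// => i _.
rewrite /clip (max_idPl _) ?scale0r//.
rewrite ge_min; apply/orP; right; rewrite natrD mulrDl.
have : 0 <= i%:R * d by rewrite mulr_ge0// ltW.
by move: xm; lra.
Qed.

(** The increment weights [f (i * d)] by the length in which the [i]-th cell meets [[x, y]]. A cell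
    of nonzero weight starts between [x - d] and [y], where [f] is within [e] of [c]. *)
Let step_prim_incr d n x y c e : 0 < d -> 0 <= x -> x <= y -> y <= n%:R * d ->
    (forall z : R, 0 <= z -> x - d <= z -> z <= y -> `|f z - c| <= e) ->
  `|step_prim d n y - step_prim d n x - (y - x) *: c| <= e * (y - x).
Proof.
move=> d0 x0 xy yn Hc.
have yx : y - x = \sum_(i < n) (clip d i y - clip d i x).
  rewrite sumrB !clip_sum ?(le_trans x0)//.
  by rewrite !(min_idPl _)// (le_trans xy).
rewrite yx /step_prim -sumrB scaler_suml -sumrB mulr_sumr.
apply: le_trans (ler_norm_sum _ _ _) _; apply: ler_sum => i _.
rewrite -scalerBl -scalerBr normrZ.
have w0 : 0 <= clip d i y - clip d i x by rewrite subr_ge0 clip_mono.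
rewrite ger0_norm// mulrC.
have [->|wn0] := eqVneq (clip d i y - clip d i x) 0; first by rewrite !mulr0.
apply: ler_wpM2r => //; apply: Hc.
- by rewrite mulr_ge0// ltW.
- rewrite leNgt; apply: contra wn0 => h; rewrite subr_eq0; apply/eqP.
  rewrite /clip !(min_idPl _)//; lra.
- rewrite leNgt; apply: contra wn0 => h; rewrite subr_eq0; apply/eqP.
  rewrite /clip !(max_idPl _)// ge_min; apply/orP; right; lra.
Qed.

Hypothesis f_uc : forall e : R, 0 < e -> exists2 delta : R, 0 < delta &
  forall x y : R, 0 <= x -> 0 <= y -> `|x - y| < delta -> `|f x - f y| <= e.

Let cells (d x : R) : nat := (Num.trunc (x / d)).+1.

(** The number of cells grows with [x]; by [step_prim_widen] extra cells contribute nothing, so the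
    values at two points can be computed with the same cells. *)
Let prim (d x : R) := step_prim d (cells d x) x.

Let prim_bound d x : 0 < d -> x <= (cells d x)%:R * d.
Proof. by move=> d0; rewrite -ler_pdivrMr// ltW// truncnS_gt. Qed.

Let prim_incr d x xi y e delta : 0 < d -> 0 <= x -> x <= xi -> xi <= y ->
    d < delta -> y - x < delta ->
    (forall x y : R, 0 <= x -> 0 <= y -> `|x - y| < 2 * delta -> `|f x - f y| <= e) ->
  `|prim d y - prim d x - (y - x) *: f xi| <= e * (y - x).
Proof.
move=> d0 x0 xxi xiy dd yx Hd.
have xy := le_trans xxi xiy.
have -> : prim d x = step_prim d (cells d y) x.
  rewrite /prim [RHS](step_prim_widen d0 _ (prim_bound x d0))//.
  by rewrite ltnS le_truncn// ler_pM2r// invr_gt0.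
apply: step_prim_incr => //; first exact: prim_bound.
move=> z z0 xz zy; apply: Hd => //; first exact: le_trans xxi.
rewrite ltr_norml; apply/andP; split; lra.
Qed.

Let prim0 d : prim d 0 = 0.
Proof.
rewrite /prim /step_prim big1// => i _.
rewrite /clip (max_idPl _) ?scale0r// ge_min; apply/orP.
have [d0|d0] := leP d 0; [by left|right].
have : 0 <= i%:R * d by rewrite mulr_ge0// ltW.
by lra.
Qed.

(** The step primitives of mesh [1 / (n + 1)] satisfy the required estimate with constants uniform
    in [n]. Chaining it makes them pointwise Cauchy, and the estimate survives in the limit. *)
Lemma unif_primitive_exists : exists2 F, unif_primitive f F & F 0 = 0.
Proof.
pose d n : R := n.+1%:R^-1.
have d0 n : 0 < d n by rewrite invr_gt0.
have Hd (e : R) : 0 < e -> exists2 delta : R, 0 < delta & exists N, forall n,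
    (N <= n)%N -> forall x xi y : R, 0 <= x -> x <= xi -> xi <= y ->
    y - x < delta ->
    `|prim (d n) y - prim (d n) x - (y - x) *: f xi| <= e * (y - x).
  move=> e0; have [de de0 Hde] := f_uc e0.
  have de20 : 0 < de / 2 by lra.
  have [N HN] := small_inv de20.
  exists (de / 2) => //; exists N => n Nn x xi y x0 xxi xiy yx.
  apply: (prim_incr _ x0 xxi xiy (HN _ Nn) yx) => // a b a0 b0 ab.
  by apply: Hde => //; apply: lt_le_trans ab _; lra.
have cvgF x : 0 <= x -> cvg ((fun n => prim (d n) x) @ \oo).
  move=> x0; apply: seq_cauchy_cvg => e e0.
  (* Two step primitives differ over [[a, b]] by at most [2 * (b - a)] times this constant, hence at
     [x] by at most [e * (x / (x + 1))]. *)
  have e'0 : 0 < e / (2 * (x + 1)) by rewrite divr_gt0//; lra.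
  have [delta delta0 [N HN]] := Hd _ e'0.
  exists N => m n Nm Nn.
  have := @interval_chain R (fun a b =>
    `|(prim (d m) b - prim (d n) b) - (prim (d m) a - prim (d n) a)|
      <= 2 * (e / (2 * (x + 1))) * (b - a)) 0 delta delta0.
  move=> /(_ _ _ 0 x (lexx _) x0); rewrite !prim0 !subr0 => H.
  apply: le_trans (H _ _) _.
  - move=> a c b a0 ac cb h1 h2.
    have -> : prim (d m) b - prim (d n) b - (prim (d m) a - prim (d n) a) =
      (prim (d m) b - prim (d n) b - (prim (d m) c - prim (d n) c)) +
      (prim (d m) c - prim (d n) c - (prim (d m) a - prim (d n) a)) by lin R.
    apply: le_trans (ler_normD _ _) _.
    by apply: le_trans (lerD h2 h1) _; rewrite -mulrDr addrA subrK.
  - move=> a b a0 ab ba.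
    have h1 := HN _ Nm a a b a0 (lexx _) ab ba.
    have h2 := HN _ Nn a a b a0 (lexx _) ab ba.
    have -> : prim (d m) b - prim (d n) b - (prim (d m) a - prim (d n) a) =
      (prim (d m) b - prim (d m) a - (b - a) *: f a) -
      (prim (d n) b - prim (d n) a - (b - a) *: f a) by lin R.
    by apply: le_trans (ler_normB _ _) _; lra.
  - have -> : 2 * (e / (2 * (x + 1))) * x = e * (x / (x + 1)) by field; lra.
    by rewrite ler_piMr// ?(ltW e0)// ler_pdivrMr; lra.
exists (fun x => lim ((fun n => prim (d n) x) @ \oo)); last first.
  by under eq_fun do rewrite prim0; rewrite lim_cst.
move=> e e0; have [delta delta0 [N HN]] := Hd _ e0.
exists delta => // x xi y x0 xxi xiy yx.
have y0 : 0 <= y by lra.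
apply: (@lim_norm_le _ _ _ \oo _ (fun n => prim (d n) y - prim (d n) x)).
  by apply: cvgB; exact: cvgF.
by exists N => // n /= Nn; exact: HN.
Qed.

End primitive_existence.

(** * Riemann and improper integrals computed from primitives *)

Lemma riemann_sum_cons (R : realType) (X : normedModType R) (f : R -> X)
    (a x : R) (s : seq R) (xi : nat -> R) :
  riemann_sum f a (x :: s) xi =
  (x - a) *: f (xi 0%N) + riemann_sum f x s (fun i => xi i.+1).
Proof. by rewrite /riemann_sum big_ord_recl. Qed.

Lemma unif_primitive_riemann (R : realType) (X : normedModType R)
    (f F : R -> X) (b : R) : unif_primitive f F ->
  is_riemann_integral f 0 b (F b - F 0).
Proof.
move=> HF eps eps0.
(* The errors of the subintervals add up to at most this constant times [b], hence to at most
   [eps / 2]. *)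
have e0 : 0 < eps / (2 * (`|b| + 1)) by rewrite divr_gt0// mulr_gt0// ltr_wpDl.
have [delta d0 Hd] := HF _ e0.
exists delta => // s xi sb Hxi.
suff H a : 0 <= a -> itv_partition a b s ->
    (forall i, (i < size s)%N ->
      s`_i - (a :: s)`_i < delta /\ (a :: s)`_i <= xi i <= s`_i) ->
    `|riemann_sum f a s xi - (F b - F a)| <= eps / (2 * (`|b| + 1)) * (b - a).
  apply: le_lt_trans (H 0 (lexx _) sb Hxi) _; rewrite subr0.
  have b1 : 0 < `|b| + 1 by rewrite ltr_wpDl.
  have -> : eps / (2 * (`|b| + 1)) * b = eps * (b / (`|b| + 1)) / 2.
    by field; exact: lt0r_neq0.
  have h : b / (`|b| + 1) <= 1.
    by rewrite ler_pdivrMr// mul1r (le_trans (ler_norm _))// lerDl.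
  have := ler_wpM2l (ltW eps0) h; lra.
elim: s a xi {sb Hxi} => [|x s IH] a xi a0 sb Hxi.
  by rewrite -(itv_partition_nil sb) /riemann_sum big_ord0 !subrr normr0 mulr0.
have ax : a < x by case: sb => /= /andP[].
rewrite riemann_sum_cons.
have -> : (x - a) *: f (xi 0%N) + riemann_sum f x s (fun i => xi i.+1) -
    (F b - F a) = (riemann_sum f x s (fun i => xi i.+1) - (F b - F x)) -
    (F x - F a - (x - a) *: f (xi 0%N)) by lin R.
have x0 : 0 <= x by apply: le_trans a0 (ltW ax).
have h1 := IH x (fun i => xi i.+1) x0 (itv_partition_cons sb)
  (fun i => Hxi i.+1).
have /= [xad /andP[axi xix]] := Hxi 0%N isT.
have h2 := Hd _ _ _ a0 axi xix xad.
by apply: le_trans (ler_normB _ _) _; lra.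
Qed.

Lemma fine_partition (R : realType) (a b delta : R) : 0 < delta -> a <= b ->
  exists s, itv_partition a b s /\ forall i, (i < size s)%N ->
    s`_i - (a :: s)`_i < delta /\ (a :: s)`_i <= s`_i.
Proof.
move=> d0 ab.
pose e := [rel u v : R | (u < v) && (v - u < delta)].
(* The relation being chained is the existence of a strictly increasing path with steps below
   [delta]; the path is empty when the endpoints coincide. *)
have [s sp sl] : exists2 s, path e a s & last a s = b.
  apply: (@interval_chain _ (fun x y => exists2 s, path e x s & last x s = y)
    a _ d0) => //.
    move=> x z y _ _ _ [s1 p1 l1] [s2 p2 l2]; exists (s1 ++ s2).
      by rewrite cat_path p1 l1.
    by rewrite last_cat l1.
  move=> x y _; rewrite le_eqVlt => /predU1P[-> _|xy yx].
    by exists [::].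
  by exists [:: y] => //=; rewrite xy yx.
exists s; split.
  split; last by rewrite sl.
  by apply: sub_path sp => u v /andP[].
by move=> i si; have /(pathP 0) /(_ i si) /= /andP[/ltW] := sp.
Qed.

Lemma riemann_integral_unique (R : realType) (X : normedModType R) (f : R -> X)
    (a b : R) (I I' : X) : a <= b ->
  is_riemann_integral f a b I -> is_riemann_integral f a b I' -> I = I'.
Proof.
move=> ab HI HI'; apply/eqP; rewrite -subr_eq0 -normr_le0.
apply/ler_addgt0Pr => e e0; rewrite add0r.
have e20 : 0 < e / 2 by lra.
have [d d0 Hd] := HI _ e20; have [d' d'0 Hd'] := HI' _ e20.
have dd0 : 0 < Num.min d d' by rewrite lt_min d0.
have [s [sab Hs]] := fine_partition dd0 ab.
have h1 : `|riemann_sum f a s (nth 0 s) - I| < e / 2.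
  apply: Hd => // i si; have [+ h] := Hs i si.
  by rewrite lt_min => /andP[-> _]; rewrite h lexx.
have h2 : `|riemann_sum f a s (nth 0 s) - I'| < e / 2.
  apply: Hd' => // i si; have [+ h] := Hs i si.
  by rewrite lt_min => /andP[_ ->]; rewrite h lexx.
have -> : I - I' = (riemann_sum f a s (nth 0 s) - I') -
  (riemann_sum f a s (nth 0 s) - I) by lin R.
by apply: le_trans (ler_normB _ _) _; lra.
Qed.

(** [F] is a witness for the definition, and any other witness agrees with it on [[0, +oo)] by
    uniqueness of Riemann integrals, so the choice made by [xget] is forced. *)
Lemma unif_primitive_improper (R : realType) (X : normedModType R)
    (f F : R -> X) (I : X) :
    unif_primitive f F -> F 0 = 0 -> F b @[b --> +oo] --> I ->
  improper_integral f 0 = I.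
Proof.
move=> HF F0 FI; apply: xget_unique.
  exists F; split => // b _; rewrite -[F b]subr0 -F0.
  exact: unif_primitive_riemann.
move=> I' [F' [HF' F'I']].
apply: (@cvg_unique _ _ (F' b @[b --> +oo])) => //.
apply: cvg_trans FI; apply: near_eq_cvg.
near=> b; have b0 : 0 <= b by near: b; exact: nbhs_pinfty_ge.
apply: (@riemann_integral_unique _ _ f 0 b) => //; last exact: HF'.
by rewrite -[F b]subr0 -F0; exact: unif_primitive_riemann.
Unshelve. all: end_near. Qed.

(* The tags are chosen by the mean value theorem for G, so that the comparison
   of Riemann sums telescopes. *)
Lemma unif_primitive_le (R : realType) (X : normedModType R)
    (f F : R -> X) (G dG : R -> R) :
    unif_primitive f F -> (forall x : R, is_derive x 1 G (dG x)) ->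
  forall a b : R, 0 <= a -> a <= b ->
    (forall x : R, a <= x -> x <= b -> `|f x| <= dG x) ->
  `|F b - F a| <= G b - G a.
Proof.
move=> HF HG a b a0 ab fG; apply/ler_addgt0Pr => e e0.
have e'0 : 0 < e / (b - a + 1) by rewrite divr_gt0//; lra.
have [d d0 Hd] := HF _ e'0.
have H : `|F b - F a| <= G b - G a + e / (b - a + 1) * (b - a).
  apply: (@interval_chain _ (fun x y => y <= b ->
    `|F y - F x| <= G y - G x + e / (b - a + 1) * (y - x)) a _ d0) => //.
    move=> x z y _ _ zy Hxz Hzy yb.
    have h1 := Hxz (le_trans zy yb); have h2 := Hzy yb.
    have -> : F y - F x = (F y - F z) + (F z - F x) by lin R.
    apply: le_trans (ler_normD _ _) _; lra.
  move=> x y ax xy yx yb.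
  have cG : {within `[x, y], continuous G}.
    apply: continuous_subspaceT => z; apply: differentiable_continuous.
    by apply/derivable1_diffP; have [] := HG z.
  have [c] := MVT_segment xy (fun z _ => HG z) cG.
  rewrite in_itv/= => /andP[xc cy] ->.
  have x0 : 0 <= x by apply: le_trans a0 ax.
  have h1 := Hd _ _ _ x0 xc cy yx.
  have -> : F y - F x = (F y - F x - (y - x) *: f c) + (y - x) *: f c by lin R.
  apply: le_trans (ler_normD _ _) _.
  have yx0 : 0 <= y - x by rewrite subr_ge0.
  have := ler_wpM2r yx0 (fG c (le_trans ax xc) (le_trans cy yb)).
  rewrite normrZ (ger0_norm yx0) => h2; lra.
apply: le_trans H _; rewrite lerD2l.
have -> : e / (b - a + 1) * (b - a) = e * ((b - a) / (b - a + 1)).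
  by field; lra.
by rewrite ler_piMr// ?(ltW e0)// ler_pdivrMr; lra.
Qed.

Lemma unif_primitive_unique (R : realType) (X : normedModType R)
    (f F F' : R -> X) : unif_primitive f F -> unif_primitive f F' ->
  forall x : R, 0 <= x -> F x - F 0 = F' x - F' 0.
Proof.
move=> HF HF' x x0.
have := unif_primitive_le (G := cst 0) (dG := cst 0) (unif_primitiveB HF HF')
  (fun x => is_derive_cst _ _ _).
move=> /(_ 0 x (lexx _) x0) /=; rewrite subrr normr_le0 => H.
apply/eqP; rewrite -subr_eq0.
have -> : F x - F 0 - (F' x - F' 0) = F x - F' x - (F 0 - F' 0) by lin R.
by apply: H => y _ _; rewrite subrr normr0.
Qed.

(** * Bounded uniformly continuous functions *)

Lemma BUC_bounded (R : realType) (X : normedModType R) (u : BUC X) :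
  exists2 M : R, 0 <= M & forall t : R, `|u t| <= M.
Proof.
have [M [_ HM]] := (BUC_funP u).1.
exists (`|M| + 1) => [|t]; first by rewrite addr_ge0.
by apply: HM => //; rewrite (le_lt_trans (ler_norm M))// ltrDl.
Qed.

Lemma BUC_uc (R : realType) (X : normedModType R) (u : BUC X) (e : R) :
  0 < e -> exists2 d : R, 0 < d &
    forall s t : R, `|s - t| < d -> `|u s - u t| <= e.
Proof.
move=> e0; have /unif_continuousP /(_ e e0) [d d0 Hd] := (BUC_funP u).2.
exists d => // s t std; have := Hd (s, t).
by rewrite -!ball_normE /ball_ /= => /(_ std)/ltW.
Qed.

Lemma mk_bounded_unif_continuous (R : realType) (X : normedModType R)
    (u : R -> X) (M : R) :
    (forall t : R, `|u t| <= M) ->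
    (forall e : R, 0 < e -> exists2 d : R, 0 < d &
      forall s t : R, `|s - t| < d -> `|u s - u t| <= e) ->
  bounded_unif_continuous u.
Proof.
move=> uM uc; split.
  exists M; split; first exact: num_real.
  by move=> x Mx y _; apply: le_trans (uM y) (ltW Mx).
apply/unif_continuousP => e e0; have [|d d0 Hd] := uc (e / 2); first lra.
exists d => // -[s t]; rewrite -!ball_normE /ball_ /= => std.
by apply: le_lt_trans (Hd _ _ std) _; lra.
Qed.

Lemma zero_BUC (R : realType) (X : normedModType R) :
  bounded_unif_continuous (fun _ : R => 0 : X).
Proof.
apply: (@mk_bounded_unif_continuous _ _ _ 0) => [t|e e0].
  by rewrite normr0.
by exists 1 => // s t _; rewrite subrr normr0 ltW.
Qed.

(* (1 + lambda d/dt)^-1, so that the Yosida derivative is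
   (1 - yosida_mean lambda) / lambda *)
Definition yosida_mean (R : realType) (X : normedModType R) (lambda : R)
    (u : R -> X) (t : R) : X :=
  lambda^-1 *:
    improper_integral (fun tau => expR (- tau / lambda) *: u (t - tau)) 0.

(** * Averages against an exponential weight *)

Section yosida_mean_theory.
Variables (R : realType) (lambda : R).
Hypothesis lambda0 : 0 < lambda.

Let w (tau : R) := expR (- tau / lambda).

Let w_gt0 tau : 0 < w tau. Proof. exact: expR_gt0. Qed.

Let w0 : w 0 = 1. Proof. by rewrite /w oppr0 mul0r expR0. Qed.

Let wD a b : w (a + b) = w a * w b.
Proof. by rewrite /w opprD mulrDl expRD. Qed.

Let w_le1 tau : 0 <= tau -> w tau <= 1.
Proof.
move=> t0; rewrite /w -expR0 ler_expR mulNr oppr_le0 mulr_ge0// invr_ge0.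
exact: ltW.
Qed.

Let w_lip x y : 0 <= x -> x <= y -> 0 <= w x - w y <= (y - x) / lambda.
Proof.
move=> x0 xy; have -> : w y = w x * w (y - x) by rewrite -wD addrC subrK.
have yx0 : 0 <= y - x by lra.
have h1 := w_le1 x0; have h2 := w_le1 yx0; have h3 := w_gt0 x.
have h4 : 1 - (y - x) / lambda <= w (y - x).
  by rewrite -mulNr; exact: expR_ge1Dx.
have -> : w x - w x * w (y - x) = w x * (1 - w (y - x)) by ring.
have h5 : 0 <= 1 - w (y - x) by lra.
apply/andP; split; first by rewrite mulr_ge0// ltW.
by apply: le_trans (ler_piMl h5 h1) _; lra.
Qed.

Let w_lip_norm x y : 0 <= x -> 0 <= y -> `|w x - w y| <= `|x - y| / lambda.
Proof.
move=> x0 y0; wlog xy : x y x0 y0 / x <= y => [H|].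
  have [|/ltW yx] := leP x y; first exact: H.
  by rewrite distrC [in leRHS]distrC; exact: H.
have /andP[h1 h2] := w_lip x0 xy.
by rewrite ger0_norm// distrC ger0_norm// subr_ge0.
Qed.

(** The antiderivative of [w tau * (A0 + A1 * tau + A2 * tau ^+ 2)] that vanishes at infinity. *)
Let poly_prim (A0 A1 A2 tau : R) :=
  - lambda * (w tau * (A0 + A1 * (tau + lambda) +
    A2 * (tau ^+ 2 + 2 * lambda * tau + 2 * lambda ^+ 2))).

Let is_derive_w (x : R) : is_derive x 1 w (- (w x / lambda)).
Proof.
have h : is_derive x 1 (fun y : R => - y / lambda) (- lambda^-1).
  have -> : (fun y : R => - y / lambda) = (- lambda^-1) *: (@id R).
    by apply/funext => y; rewrite !fctE /GRing.scale/=; ring.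
  by apply: is_derive_eq; rewrite scaler1.
have -> : w = expR \o (fun y : R => - y / lambda) by [].
by apply: is_derive_eq; rewrite /= /GRing.scale /= ?mulrN ?mulNr -/(w x) // mulrC.
Qed.

Let is_derive_poly_prim A0 A1 A2 (x : R) :
  is_derive x 1 (poly_prim A0 A1 A2) (w x * (A0 + A1 * x + A2 * x ^+ 2)).
Proof.
have h : is_derive x 1 (fun tau : R => A0 + A1 * (tau + lambda) +
    A2 * (tau ^+ 2 + 2 * lambda * tau + 2 * lambda ^+ 2))
    (A1 + A2 * (2 * x + 2 * lambda)).
  have -> : (fun tau : R => A0 + A1 * (tau + lambda) +
      A2 * (tau ^+ 2 + 2 * lambda * tau + 2 * lambda ^+ 2)) =
    cst (A0 + A1 * lambda + 2 * A2 * lambda ^+ 2) +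
    (A1 + 2 * lambda * A2) *: (@id R) + A2 *: (@id R * @id R).
    by apply/funext => y; rewrite !fctE /GRing.scale/=; ring.
  have h1 : is_derive x 1 (@id R) 1 by exact: is_derive_id.
  have h2 := is_deriveZ A2 (is_deriveM h1 h1).
  have h3 := is_deriveZ (A1 + 2 * lambda * A2) h1.
  have h4 := is_derive_cst (A0 + A1 * lambda + 2 * A2 * lambda ^+ 2) x 1.
  apply: (is_derive_eq (is_deriveD (is_deriveD h4 h3) h2)).
  by rewrite /GRing.scale/=; ring.
apply: (is_derive_eq (is_deriveZ (- lambda) (is_deriveM (is_derive_w x) h))).
rewrite /GRing.scale/=; set wx := w x; field; exact: lt0r_neq0.
Qed.

(** The cubic term of the exponential series gives [w b * b ^+ 3 <= 6 * lambda ^+ 3]; one factor [b]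
    is left over to beat [K]. *)
Let w_cvg0 (K e : R) : 0 < e -> exists2 b0 : R, 1 <= b0 &
  forall b : R, b0 <= b -> K * (w b * b ^+ 2) <= e.
Proof.
move=> e0; pose C := `|K| * 6 * lambda ^+ 3 / e.
have C0 : 0 <= C.
  have l3 := exprn_ge0 3 (ltW lambda0).
  by rewrite divr_ge0 ?(ltW e0)// mulr_ge0// mulr_ge0.
exists (C + 1) => [|b Cb]; first lra.
have b0 : 0 < b by lra.
have bl : 0 <= b / lambda by rewrite divr_ge0 ?ltW.
have h : w b * b ^+ 3 <= 6 * lambda ^+ 3.
  have := expR_ge1Dxn 2 bl; rewrite (_ : 3`!%:R = 6)// => h.
  have we : w b * expR (b / lambda) = 1.
    by rewrite /w -expRD mulNr addNr expR0.
  have : w b * ((b / lambda) ^+ 3 / 6) <= w b * expR (b / lambda).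
    by rewrite ler_pM2l//; lra.
  rewrite we.
  have -> : w b * ((b / lambda) ^+ 3 / 6) = (w b * b ^+ 3) / (6 * lambda ^+ 3).
    by field; exact: lt0r_neq0.
  by rewrite ler_pdivrMr ?mul1r// mulr_gt0// exprn_gt0.
have h2 : `|K| * (w b * b ^+ 3) <= e * b.
  apply: (@le_trans _ _ (e * C)); last by rewrite ler_pM2l//; lra.
  have -> : e * C = `|K| * (6 * lambda ^+ 3).
    by rewrite /C; field; exact: lt0r_neq0.
  exact: ler_wpM2l.
rewrite -(ler_pM2r b0); apply: le_trans h2.
have -> : K * (w b * b ^+ 2) * b = K * (w b * b ^+ 3) by ring.
apply: ler_wpM2r; last exact: ler_norm.
by rewrite mulr_ge0// ?exprn_ge0// ltW.
Qed.

Variables (X : completeNormedModType R).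

Let weighted_le (f F : R -> X) (I : X) A0 A1 A2 :
    unif_primitive f F -> F 0 = 0 -> F b @[b --> +oo] --> I ->
    (forall x : R, 0 <= x -> `|f x| <= w x * (A0 + A1 * x + A2 * x ^+ 2)) ->
  `|I| <= lambda * (A0 + A1 * lambda + 2 * A2 * lambda ^+ 2).
Proof.
move=> HF F0 FI Hf; apply/ler_addgt0Pr => e e0.
rewrite -[I]subr0; apply: (lim_norm_le FI).
(* For [b >= 1] both [1] and [b] are at most [b ^+ 2], so [K * (w b * b ^+ 2)] dominates the value
   of [poly_prim] at [b]. *)
pose K := lambda * (`|A0| + `|A1| * (1 + lambda) +
  `|A2| * (1 + 2 * lambda + 2 * lambda ^+ 2)).
have [b0 b01 Hb] := w_cvg0 K e0.
near=> b; rewrite subr0 -[F b]subr0 -F0.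
have b0b : b0 <= b.
  by near: b; apply: nbhs_pinfty_ge; exact: num_real.
have bge0 : 0 <= b by lra.
have := unif_primitive_le HF (is_derive_poly_prim A0 A1 A2) (lexx 0) bge0.
move=> /(_ (fun x x0 _ => Hf x x0)) H; apply: le_trans H _.
have -> : poly_prim A0 A1 A2 0 =
    - (lambda * (A0 + A1 * lambda + 2 * A2 * lambda ^+ 2)).
  by rewrite /poly_prim w0; ring.
rewrite opprK addrC lerD2l; apply: le_trans (Hb b b0b).
rewrite /poly_prim.
have -> : K * (w b * b ^+ 2) = lambda * (w b * (b ^+ 2 *
  (`|A0| + `|A1| * (1 + lambda) + `|A2| * (1 + 2 * lambda + 2 * lambda ^+ 2)))).
  by rewrite /K; ring.
rewrite mulNr -mulrN ler_pM2l// -mulrN ler_pM2l//.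
have b1 : 1 <= b by lra.
have bb : b <= b ^+ 2 by rewrite expr2; nra.
have b2 : 1 <= b ^+ 2 by lra.
have nA (a : R) : - a <= `|a| by have := ler_norm (- a); rewrite normrN.
rewrite [in leLHS]opprD [in leLHS]opprD ![b ^+ 2 * (_ + _)]mulrDr.
apply: lerD; first apply: lerD.
- by apply: le_trans (nA A0) _; rewrite ler_peMl.
- rewrite -mulNr; have h1 : 0 <= b + lambda by rewrite addr_ge0// ltW.
  apply: le_trans (ler_wpM2r h1 (nA A1)) _.
  rewrite [leRHS]mulrCA; apply: ler_wpM2l => //.
  by rewrite mulrDr mulr1 lerD// ler_peMl// ltW.
- rewrite -mulNr; have l2 := exprn_ge0 2 (ltW lambda0).
  have h1 : 0 <= b ^+ 2 + 2 * lambda * b + 2 * lambda ^+ 2.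
    by rewrite !addr_ge0// !mulr_ge0// ltW.
  apply: le_trans (ler_wpM2r h1 (nA A2)) _.
  rewrite [leRHS]mulrCA; apply: ler_wpM2l => //.
  rewrite !mulrDr mulr1 !lerD//; last by rewrite ler_peMl// mulr_ge0.
  by rewrite mulrC ler_wpM2r// mulr_ge0// ltW.
Unshelve. all: end_near. Qed.

Let w_norm tau : `|w tau| = w tau. Proof. by rewrite gtr0_norm. Qed.

Let integrand_uc (u : BUC X) (t e : R) : 0 < e -> exists2 delta : R, 0 < delta &
  forall x y : R, 0 <= x -> 0 <= y -> `|x - y| < delta ->
    `|w x *: u (t - x) - w y *: u (t - y)| <= e.
Proof.
move=> e0; have [M M0 HM] := BUC_bounded u.
have [|d d0 Hd] := BUC_uc u (_ : 0 < e / 2); first lra.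
have d'0 : 0 < e * lambda / (2 * (M + 1)).
  by rewrite divr_gt0// mulr_gt0//; lra.
exists (Num.min d (e * lambda / (2 * (M + 1)))); first by rewrite lt_min d0.
move=> x y x0 y0; rewrite lt_min => /andP[xyd xyd'].
have -> : w x *: u (t - x) - w y *: u (t - y) =
  w x *: (u (t - x) - u (t - y)) + (w x - w y) *: u (t - y) by lin R.
apply: le_trans (ler_normD _ _) _; rewrite !normrZ.
have h1 : `|w x| * `|u (t - x) - u (t - y)| <= e / 2.
  have hu : `|u (t - x) - u (t - y)| <= e / 2.
    by apply: Hd; rewrite opprB addrC addrA subrK distrC.
  rewrite w_norm; apply: le_trans hu.
  by rewrite ler_piMl// w_le1.
have h2 : `|w x - w y| * `|u (t - y)| <= e / 2.
  apply: (@le_trans _ _ (`|x - y| / lambda * (M + 1))).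
    apply: ler_pM => //; first exact: w_lip_norm.
    by apply: le_trans (HM _) _; lra.
  have -> : e / 2 = (e * lambda / (2 * (M + 1))) / lambda * (M + 1).
    by field; rewrite lt0r_neq0//; lra.
  by rewrite ler_pM2r ?ler_pM2r ?invr_gt0//; lra.
lra.
Qed.

(** The weight [w] has total mass [lambda]; subtracting this primitive turns the mean of [u] minus
    [c] into the mean of [u - c]. *)
Let const_primitive (c : X) :
  unif_primitive (fun tau => w tau *: c) (fun tau => (lambda * (1 - w tau)) *: c).
Proof.
move=> e e0; exists (lambda * e / (`|c| + 1)).
  by rewrite divr_gt0 ?mulr_gt0// ltr_wpDl.
move=> x xi y x0 xxi xiy yx.
have c10 : 0 < `|c| + 1 by rewrite ltr_wpDl.
have xy : x <= y by lra.
have cw : {within `[x, y], continuous w}.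
  apply: continuous_subspaceT => z; apply: differentiable_continuous.
  by apply/derivable1_diffP; have [] := is_derive_w z.
have [z] := MVT_segment xy (fun z _ => is_derive_w z) cw.
rewrite in_itv/= => /andP[xz zy] wyx.
have -> : (lambda * (1 - w y)) *: c - (lambda * (1 - w x)) *: c -
   (y - x) *: (w xi *: c) = ((y - x) * (w z - w xi)) *: c.
  have -> : w y = w x - w z / lambda * (y - x) by lra.
  by lin_eq R; field; exact: lt0r_neq0.
have yx0 : 0 <= y - x by lra.
rewrite normrZ normrM (ger0_norm yx0) -mulrA mulrC; apply: ler_wpM2r => //.
have xi0 : 0 <= xi by lra.
have z0 : 0 <= z by lra.
have h : `|w z - w xi| <= (y - x) / lambda.
  apply: le_trans (w_lip_norm z0 xi0) _; rewrite ler_pM2r ?invr_gt0//.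
  by rewrite ler_norml; apply/andP; split; lra.
apply: le_trans (ler_wpM2r (normr_ge0 c) h) _.
apply: (@le_trans _ _ ((lambda * e / (`|c| + 1)) / lambda * (`|c| + 1))).
  apply: ler_pM => //; [by rewrite divr_ge0// ltW| |lra].
  by rewrite ler_pM2r ?invr_gt0//; lra.
rewrite le_eqVlt; apply/orP; left; apply/eqP; field.
by rewrite !lt0r_neq0.
Qed.

Let w_lim : w b @[b --> +oo] --> (0 : R).
Proof.
apply/cvgrPdist_le => e e0; have [b0 b01 Hb] := w_cvg0 1 e0.
near=> b; have b0b : b0 <= b.
  by near: b; apply: nbhs_pinfty_ge; exact: num_real.
rewrite sub0r normrN w_norm; apply: le_trans (Hb _ b0b).
rewrite mul1r ler_peMr ?(ltW (w_gt0 _))// expr2.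
have b1 : 1 <= b by lra.
nra.
Unshelve. all: end_near. Qed.

Let const_lim (c : X) : (lambda * (1 - w b)) *: c @[b --> +oo] --> lambda *: c.
Proof.
rewrite -[in X in _ --> X](mulr1 lambda) -[in X in _ --> X](subr0 1).
apply: cvgZr_tmp; apply: cvgMr; apply: cvgB; first exact: cvg_cst.
exact: w_lim.
Qed.

(** Beyond [a] the primitive moves by at most [lambda * M * w a], so it converges at infinity. Hence
    [improper_integral] is a genuine integral here and not its default value 0. *)
Let mean_primitive (u : BUC X) (t : R) : exists F,
  [/\ unif_primitive (fun tau => w tau *: u (t - tau)) F, F 0 = 0 &
      F b @[b --> +oo] --> lambda *: yosida_mean lambda u t].
Proof.
have [F HF F0] := unif_primitive_exists (integrand_uc u t).
exists F; split => //.
have [M M0 HM] := BUC_bounded u.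
have inc a b : 0 <= a -> a <= b -> `|F b - F a| <= lambda * M * w a.
  move=> a0 ab; have := unif_primitive_le HF (is_derive_poly_prim M 0 0) a0 ab.
  rewrite /poly_prim !mul0r !addr0 => H; apply: le_trans (H _) _.
    move=> x ax _; rewrite normrZ w_norm.
    by rewrite !mul0r !addr0 ler_pM2l.
  have : 0 <= lambda * (M * w b) by rewrite !mulr_ge0// ltW.
  by lra.
have cF : cvg (F b @[b --> +oo]).
  apply/cauchy_cvgP/cauchy_exP => e e0.
  have e20 : 0 < e / 2 by lra.
  have [b0 b01 Hb] := w_cvg0 (lambda * M) e20.
  exists (F b0); suff : \forall b \near +oo, ball (F b0) e (F b) by [].
  near=> b; rewrite -ball_normE /ball_ /=.
  have b0b : b0 <= b by near: b; apply: nbhs_pinfty_ge; exact: num_real.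
  have b00 : 0 <= b0 by lra.
  rewrite distrC; apply: le_lt_trans (inc _ _ b00 b0b) _.
  apply: (@le_lt_trans _ _ (lambda * M * (w b0 * b0 ^+ 2))).
    rewrite ler_wpM2l ?mulr_ge0 ?(ltW lambda0)// ler_peMr ?(ltW (w_gt0 _))// expr2.
    by nra.
  by apply: le_lt_trans (Hb _ (lexx _)) _; lra.
move/cvg_ex : cF => [I FI].
by rewrite /yosida_mean (unif_primitive_improper HF F0 FI) scalerA divff
  ?lt0r_neq0// scale1r.
Unshelve. all: end_near. Qed.

(** [yosida_mean] averages the past against the exponential law of mean [lambda], whose first two
    moments are [lambda] and [2 * lambda ^+ 2]. The coefficients may be negative, which the doubling
    of variables exploits. *)
Lemma yosida_mean_dist_poly (u : BUC X) (t : R) (c : X) (A0 A1 A2 : R) :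
    (forall tau : R, 0 <= tau -> `|u (t - tau) - c| <= A0 + A1 * tau + A2 * tau ^+ 2) ->
  `|yosida_mean lambda u t - c| <= A0 + A1 * lambda + 2 * A2 * lambda ^+ 2.
Proof.
move=> H; have [F [HF F0 FI]] := mean_primitive u t.
have := weighted_le (A0 := A0) (A1 := A1) (A2 := A2)
  (unif_primitiveB HF (const_primitive c)) _ (cvgB FI (@const_lim c)).
rewrite /= F0 w0 subrr mulr0 scale0r subrr -scalerBr normrZ gtr0_norm//.
rewrite ler_pM2l//; apply => // x x0.
by rewrite -scalerBr normrZ w_norm ler_pM2l// H.
Qed.

Lemma yosida_mean_dist (u v : BUC X) (s t A : R) :
    (forall tau : R, 0 <= tau -> `|u (s - tau) - v (t - tau)| <= A) ->
  `|yosida_mean lambda u s - yosida_mean lambda v t| <= A.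
Proof.
move=> H; have [F [HF F0 FI]] := mean_primitive u s.
have [G [HG G0 GI]] := mean_primitive v t.
have := weighted_le (A0 := A) (A1 := 0) (A2 := 0)
  (unif_primitiveB HF HG) _ (cvgB FI GI).
rewrite /= F0 G0 subrr -scalerBr normrZ gtr0_norm// ler_pM2l//.
rewrite mulr0 !mul0r !addr0; apply => // x x0.
by rewrite !mul0r !addr0 -scalerBr normrZ w_norm ler_pM2l// H.
Qed.

(* yosida_mean lambda u solves v + lambda v' = u: its increments over [t, t + h]
   are those of the solution for u frozen at t, up to the oscillation e. *)
Lemma yosida_mean_shift (u : BUC X) (t h e : R) : 0 <= h ->
    (forall s : R, t <= s -> s <= t + h -> `|u s - u t| <= e) ->
  `|yosida_mean lambda u (t + h) -
    (expR (- h / lambda) *: yosida_mean lambda u t +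
     (1 - expR (- h / lambda)) *: u t)| <= (1 - expR (- h / lambda)) * e.
Proof.
move=> h0 H; rewrite -/(w h).
have [F [HF F0 FI]] := mean_primitive u t.
have [G [HG G0 GI]] := mean_primitive u (t + h).
(* Translating the integrand by [h] multiplies its weight by [w h], so [K] is another primitive of
   the integrand at time [t] and agrees with [F]. *)
pose K (tau : R) := (w h)^-1 *: (G (tau + h) - G h).
have HK : unif_primitive (fun tau => w tau *: u (t - tau)) K.
  move=> eps eps0; have [|d d0 Hd] := HG (eps * w h); first exact: mulr_gt0.
  exists d => // x xi y x0 xxi xiy yx.
  have := Hd (x + h) (xi + h) (y + h); rewrite !lerD2r addr_ge0//.
  have -> : y + h - (x + h) = y - x by ring.
  move=> /(_ isT xxi xiy yx).
  have -> : t + h - (xi + h) = t - xi by ring.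
  have -> : K y - K x - (y - x) *: (w xi *: u (t - xi)) =
    (w h)^-1 *: (G (y + h) - G (x + h) - (y - x) *: (w (xi + h) *: u (t - xi))).
    rewrite wD /K; move: (w h) (w xi) (lt0r_neq0 (w_gt0 h)) => a b a0.
    by lin_eq R; field.
  rewrite normrZ gtr0_norm ?invr_gt0// => hG.
  by rewrite ler_pdivrMl//; apply: le_trans hG _; lra.
have GE (b : R) : 0 <= b -> G (b + h) = G h + w h *: F b.
  move=> b0; have := unif_primitive_unique HF HK b0.
  rewrite F0 subr0 => ->; rewrite /K add0r subrr scaler0 subr0 scalerA divff.
    by lin R.
  exact: lt0r_neq0.
have GI' : G (b + h) @[b --> +oo] --> lambda *: yosida_mean lambda u (t + h).
  apply: (@cvg_comp _ _ _ (fun b => b + h) G _ _ _ _ GI).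
  by apply: cvg_addrr.
(* The mean at [t + h] splits into the last [h] units of time, which give [G h], and the older past,
   which is the mean at [t] discounted by [w h]. *)
have EI : lambda *: yosida_mean lambda u (t + h) =
    G h + w h *: (lambda *: yosida_mean lambda u t).
  apply: (@cvg_unique _ _ (G (b + h) @[b --> +oo])) => //.
  have : G h + w h *: F b @[b --> +oo] -->
      G h + w h *: (lambda *: yosida_mean lambda u t).
    by apply: cvgD; [exact: cvg_cst|exact: cvgZl_tmp].
  apply: cvg_trans; apply: near_eq_cvg; near=> b.
  by rewrite GE//; near: b; exact: nbhs_pinfty_ge.
have := unif_primitive_le (unif_primitiveB HG (const_primitive (u t)))
  (is_derive_poly_prim e 0 0) (lexx 0) h0.
rewrite /= G0 w0 subrr mulr0 scale0r !subr0 => HB.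
have {HB} : `|G h - (lambda * (1 - w h)) *: u t| <= lambda * ((1 - w h) * e).
  apply: le_trans (HB _) _; last by rewrite /poly_prim w0; lra.
  move=> x x0 xh; rewrite mul0r !addr0 -scalerBr normrZ w_norm.
  by rewrite ler_pM2l// mul0r addr0; apply: H; lra.
have -> : G h - (lambda * (1 - w h)) *: u t = lambda *: (
  yosida_mean lambda u (t + h) -
    (w h *: yosida_mean lambda u t + (1 - w h) *: u t)).
  rewrite scalerBr EI; lin R.
by rewrite normrZ gtr0_norm// ler_pM2l.
Unshelve. all: end_near. Qed.

Lemma yosida_mean_BUC (u : BUC X) : bounded_unif_continuous (yosida_mean lambda u).
Proof.
have [M M0 HM] := BUC_bounded u.
apply: (@mk_bounded_unif_continuous _ _ _ M).
  move=> t; have := @yosida_mean_dist_poly u t 0 M 0 0.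
  by rewrite mulr0 !mul0r !addr0 subr0; apply => tau _; rewrite subr0 !mul0r !addr0.
move=> e e0; have [d d0 Hd] := BUC_uc u e0.
exists d => // s t std; apply: yosida_mean_dist => tau tau0; apply: Hd.
by rewrite opprB addrA subrK.
Qed.

End yosida_mean_theory.

(** * Self-improving bounds and moduli of continuity *)

(** The hypothesis is applied to [M = sup f]; the a priori bound [B] makes this supremum finite. *)
Lemma sup_selfbound (R : realType) (T : Type) (f : T -> R) (B theta b : R) :
    (forall t, f t <= B) -> theta < 1 ->
    (forall M, (forall t, f t <= M) -> forall t, f t <= theta * M + b) ->
  forall t, f t <= b / (1 - theta).
Proof.
move=> fB th1 Hf t0.
have hs : has_sup (range f) by split; [exists (f t0), t0 | exists B => _ [t _ <-]].
have fM t : f t <= sup (range f) by apply: (sup_ubound hs.2); exists t.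
have : sup (range f) <= theta * sup (range f) + b.
  by apply: ge_sup => [|_ [t _ <-]]; [exists (f t0), t0 | exact: Hf].
move=> h; apply: le_trans (fM t0) _; rewrite ler_pdivlMr ?subr_gt0//; lra.
Qed.

(** The case [theta = 1 / (1 + c)], shaped for [control_shift] with [c = - (lambda * omega)]. The
    bound [b] is free of [c], hence estimates obtained this way can be uniform in [lambda]. *)
Lemma sup_selfboundD (R : realType) (T : Type) (f : T -> R) (B c b : R) :
    (forall t, f t <= B) -> 0 < c ->
    (forall M, (forall t, f t <= M) -> forall t, (1 + c) * f t <= M + c * b) ->
  forall t, f t <= b.
Proof.
move=> fB c0 Hf t.
have c10 : 1 + c != 0 by rewrite lt0r_neq0//; lra.
have th1 : (1 + c)^-1 < 1 by rewrite invf_lt1; lra.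
have := sup_selfbound (b := c * b / (1 + c)) fB th1 _ t.
have -> : c * b / (1 + c) / (1 - (1 + c)^-1) = b.
  have -> : 1 - (1 + c)^-1 = c / (1 + c) by field.
  by field; rewrite c10 lt0r_neq0.
apply => M fM s; rewrite -(ler_pM2l (_ : 0 < 1 + c)); last lra.
apply: le_trans (Hf M fM s) _; rewrite le_eqVlt; apply/orP; left; apply/eqP.
by field.
Qed.

(* The affine form of uniform continuity of a pseudo-distance: unlike moduli of
   continuity, it is stable under sums and integrates in closed form against
   exponential weights. *)
Definition unif_small (R : realType) (D : R -> R -> R) :=
  forall e : R, 0 < e -> exists2 C : R, 0 <= C &
    forall t s : R, D t s <= e + C * `|t - s|.

Lemma unif_small_le (R : realType) (D D' : R -> R -> R) :
  (forall t s, D t s <= D' t s) -> unif_small D' -> unif_small D.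
Proof.
move=> DD' H e e0; have [C C0 HC] := H e e0.
by exists C => // t s; apply: le_trans (HC t s).
Qed.

Lemma unif_smallD (R : realType) (D D' : R -> R -> R) :
  unif_small D -> unif_small D' -> unif_small (fun t s => D t s + D' t s).
Proof.
move=> H H' e e0; have [|C C0 HC] := H (e / 2); first lra.
have [|C' C'0 HC'] := H' (e / 2); first lra.
exists (C + C') => [|t s]; first by rewrite addr_ge0.
have := HC t s; have := HC' t s; rewrite mulrDl; lra.
Qed.

Lemma unif_smallZ (R : realType) (D : R -> R -> R) (c : R) : 0 <= c ->
  unif_small D -> unif_small (fun t s => c * D t s).
Proof.
move=> c0 H e e0.
have c10 : 0 < c + 1 by lra.
have [|C C0 HC] := H (e / (c + 1)); first exact: divr_gt0.
exists (c * C) => [|t s]; first by rewrite mulr_ge0.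
have := ler_wpM2l c0 (HC t s); rewrite mulrDr [c * (C * _)]mulrA => h.
apply: le_trans h _; rewrite lerD2r mulrCA ler_piMr ?(ltW e0)//.
by rewrite ler_pdivrMr//; lra.
Qed.

Lemma unif_small_dist (R : realType) : unif_small (fun t s : R => `|t - s|).
Proof. by move=> e e0; exists 1 => // t s; rewrite mul1r lerDr ltW. Qed.

(** Completing the square absorbs the linear term into a quadratic one, which matches the quadratic
    penalty of the doubling of variables. *)
Lemma unif_small_quad (R : realType) (D : R -> R -> R) : unif_small D ->
  forall e : R, 0 < e -> exists2 C : R, 0 <= C &
    forall t s : R, D t s <= e + C * (t - s) ^+ 2.
Proof.
move=> H e e0; have [|C C0 HC] := H (e / 2); first lra.
exists (C ^+ 2 / (2 * e)) => [|t s]; first by rewrite divr_ge0 ?exprn_ge0//; lra.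
apply: le_trans (HC t s) _; rewrite -(real_normK (num_real (t - s))).
set q := `|t - s|.
have -> : e + C ^+ 2 / (2 * e) * q ^+ 2 = e / 2 + C * q +
    (e - C * q) ^+ 2 / (2 * e) by field; exact: lt0r_neq0.
by rewrite lerDl divr_ge0 ?sqr_ge0//; lra.
Qed.

(** At distance at least [d] the trivial bound [2 * M] is below [2 * M / d] times the distance. *)
Lemma BUC_unif_small (R : realType) (X : normedModType R) (u : BUC X) :
  unif_small (fun t s : R => `|u t - u s|).
Proof.
move=> e e0; have [M M0 HM] := BUC_bounded u.
have [d d0 Hd] := BUC_uc u e0.
exists (2 * M / d) => [|t s]; first by rewrite divr_ge0 ?(ltW d0)//; lra.
have [tsd|tsd] := ltP `|t - s| d.
  apply: le_trans (Hd _ _ tsd) _; rewrite lerDl mulr_ge0// divr_ge0 ?(ltW d0)//.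
  by rewrite mulr_ge0.
apply: (@le_trans _ _ (2 * M)).
  by apply: le_trans (ler_normB _ _) _; have := HM t; have := HM s; lra.
have : 2 * M <= 2 * M / d * `|t - s|.
  by rewrite mulrAC ler_pdivlMr// ler_wpM2l//; lra.
lra.
Qed.

Lemma unif_small_BUC (R : realType) (X : normedModType R) (u : R -> X) (M : R) :
    (forall t, `|u t| <= M) -> unif_small (fun t s : R => `|u t - u s|) ->
  bounded_unif_continuous u.
Proof.
move=> uM H; apply: (mk_bounded_unif_continuous uM) => e e0.
have [|C C0 HC] := H (e / 2); first lra.
have C10 : 0 < C + 1 by lra.
have d0 : 0 < e / 2 / (C + 1) by rewrite !divr_gt0.
exists (e / 2 / (C + 1)) => // s t std; apply: le_trans (HC s t) _.
have h : C * `|s - t| <= (C + 1) * (e / 2 / (C + 1)).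
  by apply: ler_pM => //; [lra|exact: ltW].
have -> : e = e / 2 + (C + 1) * (e / 2 / (C + 1)) by field; exact: lt0r_neq0.
by rewrite [in leLHS](_ : _ + _ * (_ / (C + 1)) = e) ?lerD2l; [lra|field; lra].
Qed.

(** The supremum runs over all of [R], so it bounds the distance of the histories at [t] and [t']
    for every delay. *)
Definition shift_dist (R : realType) (X : normedModType R) (phi : R -> X)
    (t t' : R) : R := sup_norm (fun s : R => phi (t + s) - phi (t' + s)).

Lemma sup_norm_le (R : realType) (X : normedModType R) (T : Type) (t0 : T)
    (f : T -> X) (c : R) : (forall s, `|f s| <= c) -> sup_norm f <= c.
Proof.
move=> fc; apply: ge_sup; first by exists `|f t0|, t0.
by move=> _ [s _ <-].
Qed.

Lemma le_sup_norm (R : realType) (X : normedModType R) (T : Type)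
    (f : T -> X) (c : R) (s : T) : (forall s, `|f s| <= c) ->
  `|f s| <= sup_norm f.
Proof.
move=> fc; apply: sup_ubound; last by exists s.
by exists c => _ [s' _ <-].
Qed.

Lemma shift_dist_ge (R : realType) (X : normedModType R) (phi : BUC X)
    (t t' s : R) : `|phi (t + s) - phi (t' + s)| <= shift_dist phi t t'.
Proof.
have [M M0 HM] := BUC_bounded phi.
apply: (@le_sup_norm _ _ _ (fun s => phi (t + s) - phi (t' + s)) (M + M) s) => r.
by apply: le_trans (ler_normB _ _) _; exact: lerD.
Qed.

Lemma shift_dist_unif_small (R : realType) (X : normedModType R) (phi : BUC X) :
  unif_small (shift_dist phi).
Proof.
move=> e e0; have [C C0 HC] := BUC_unif_small phi e0.
exists C => // t s; apply: (sup_norm_le 0) => r.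
by apply: le_trans (HC _ _) _; rewrite opprD addrACA subrr addr0.
Qed.

(** * Uniform limits and contractions *)

Definition unif_dist_le (R : realType) (X : normedModType R) (u v : R -> X)
  (c : R) := forall t, `|u t - v t| <= c.

Lemma BUC_dist_bounded (R : realType) (X : normedModType R) (u v : BUC X) :
  exists2 c : R, 0 <= c & unif_dist_le u v c.
Proof.
have [M M0 HM] := BUC_bounded u; have [N N0 HN] := BUC_bounded v.
exists (M + N) => [|t]; first by rewrite addr_ge0.
by apply: le_trans (ler_normB _ _) _; exact: lerD.
Qed.

Lemma BUC_cauchy_lim (R : realType) (X : completeNormedModType R)
    (w : nat -> BUC X) :
    (forall e : R, 0 < e -> exists N, forall m n, (N <= m)%N -> (N <= n)%N ->
       unif_dist_le (w m) (w n) e) ->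
  exists u : BUC X, forall e : R, 0 < e -> exists N, forall n, (N <= n)%N ->
    unif_dist_le (w n) u e.
Proof.
move=> Hw; pose u t := lim ((fun n => w n t) @ \oo).
have cu t : (fun n => w n t) @ \oo --> u t.
  apply: seq_cauchy_cvg => e e0; have [N HN] := Hw e e0.
  by exists N => m n Nm Nn; exact: HN.
have Hu e : 0 < e -> exists N, forall n, (N <= n)%N -> unif_dist_le (w n) u e.
  move=> e0; have [N HN] := Hw e e0.
  exists N => n Nn t; rewrite distrC; apply: (lim_norm_le (cu t)).
  by exists N => // m /= Nm; exact: HN.
have Hb : bounded_unif_continuous u.
  have [N HN] := Hu 1 ltr01; have [M M0 HM] := BUC_bounded (w N).
  apply: (@unif_small_BUC _ _ _ (M + 1)).
    move=> t; have := HN N (leqnn _) t; rewrite distrC => h.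
    have -> : u t = (u t - w N t) + w N t by rewrite subrK.
    by apply: le_trans (ler_normD _ _) _; have := HM t; lra.
  move=> e e0; have e40 : 0 < e / 4 by lra.
  have [N' HN'] := Hu _ e40; have [C C0 HC] := BUC_unif_small (w N') e40.
  exists C => // t s; have := HC t s.
  have := HN' N' (leqnn _) t; have := HN' N' (leqnn _) s.
  have -> : u t - u s = (w N' t - w N' s) - (w N' t - u t) + (w N' s - u s).
    by lin R.
  move=> h1 h2 h3; apply: le_trans (ler_normD _ _) _.
  by apply: (le_trans (lerD (ler_normB _ _) h1)); lra.
by exists (MkBUC Hb).
Qed.

Lemma BUC_cauchy_lim0 (R : realType) (X : completeNormedModType R)
    (w : R -> BUC X) :
    (forall e : R, 0 < e -> exists2 d : R, 0 < d & forall l m : R, 0 < l ->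
       l < d -> 0 < m -> m < d -> unif_dist_le (w l) (w m) e) ->
  exists u : BUC X, forall e : R, 0 < e -> exists2 d : R, 0 < d &
    forall l : R, 0 < l -> l < d -> unif_dist_le (w l) u e.
Proof.
move=> Hw.
have i0 n : 0 < n.+1%:R^-1 :> R by rewrite invr_gt0.
have [|u Hu] := @BUC_cauchy_lim _ _ (fun n => w (n.+1%:R^-1)).
  move=> e e0; have [d d0 Hd] := Hw e e0; have [N HN] := small_inv d0.
  by exists N => m n Nm Nn; apply: Hd => //; exact: HN.
exists u => e e0; have e20 : 0 < e / 2 by lra.
have [d d0 Hd] := Hw _ e20; have [N HN] := small_inv d0.
have [N' HN'] := Hu _ e20.
exists d => // l l0 ld t; pose n := maxn N N'.
have h1 := Hd l (n.+1%:R^-1) l0 ld (i0 n) (HN n (leq_maxl _ _)) t.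
have h2 := HN' n (leq_maxr _ _) t.
have -> : w l t - u t = (w l t - w n.+1%:R^-1 t) + (w n.+1%:R^-1 t - u t).
  by lin R.
by apply: le_trans (ler_normD _ _) _; lra.
Qed.

Lemma expr_small (R : realType) (q C e : R) : 0 <= q -> q < 1 -> 0 < e ->
  exists N, forall n, (N <= n)%N -> C * q ^+ n <= e.
Proof.
move=> q0 q1 e0.
have : (geometric C q @ \oo --> 0) by apply: cvg_geometric; rewrite ger0_norm.
move/cvgrPdist_le => /(_ e e0) [N _ HN]; exists N => n Nn.
have := HN n Nn; rewrite /= sub0r normrN; apply: le_trans; exact: ler_norm.
Qed.

Lemma BUC_contraction (R : realType) (X : completeNormedModType R)
    (T : BUC X -> BUC X) (q : R) (psi0 : BUC X) : 0 <= q -> q < 1 ->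
    (forall (u v : BUC X) (c : R),
       unif_dist_le u v c -> unif_dist_le (T u) (T v) (q * c)) ->
  exists u : BUC X, (forall t, T u t = u t) /\
    forall (psi : BUC X) (e : R), 0 < e -> exists N, forall n, (N <= n)%N ->
      unif_dist_le (iter n T psi) u e.
Proof.
move=> q0 q1 HT.
have Titer n (u v : BUC X) (c : R) : unif_dist_le u v c ->
    unif_dist_le (iter n T u) (iter n T v) (q ^+ n * c).
  move=> uv; elim: n => [|n IH]; first by rewrite mul1r.
  by rewrite exprS -mulrA; exact: HT.
have [c c0 Hc] := BUC_dist_bounded (T psi0) psi0.
(* Solves [C = q * C + c], so that the bound [C] on the distance to [psi0] is preserved by the
   iteration. *)
pose C := c / (1 - q).
have CE : q * C + c = C by rewrite /C; field; rewrite subr_eq0 gt_eqF.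
have HC n : unif_dist_le (iter n T psi0) psi0 C.
  elim: n => [|n IH] t.
    by rewrite subrr normr0 divr_ge0// subr_ge0 ltW.
  have -> : iter n.+1 T psi0 t - psi0 t =
    (T (iter n T psi0) t - T psi0 t) + (T psi0 t - psi0 t) by rewrite /=; lin R.
  apply: le_trans (ler_normD _ _) _; rewrite -CE; apply: lerD => //; exact: HT.
have [|u Hu] := @BUC_cauchy_lim _ _ (fun n => iter n T psi0).
  move=> e e0; have [|N HN] := @expr_small _ q C (e / 2) q0 q1; first lra.
  have H n : (N <= n)%N -> unif_dist_le (iter n T psi0) (iter N T psi0) (e / 2).
    move=> Nn t; rewrite -(subnKC Nn) iterD.
    apply: le_trans (Titer N _ _ _ (HC (n - N)%N) t) _.
    by rewrite mulrC; exact: HN.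
  exists N => m n Nm Nn t.
  have -> : iter m T psi0 t - iter n T psi0 t =
    (iter m T psi0 t - iter N T psi0 t) - (iter n T psi0 t - iter N T psi0 t).
    by lin R.
  by apply: le_trans (ler_normB _ _) _; have := H m Nm t; have := H n Nn t; lra.
have Tu t : T u t = u t.
  apply/eqP; rewrite -subr_eq0 -normr_le0; apply/ler_addgt0Pr => e e0.
  rewrite add0r; have e20 : 0 < e / 2 by lra.
  have [N HN] := Hu _ e20.
  have h1 := HT _ _ _ (HN N (leqnn _)) t.
  have h2 := HN N.+1 (leqnSn _) t.
  have -> : T u t - u t = (iter N.+1 T psi0 t - u t) -
    (T (iter N T psi0) t - T u t) by rewrite /=; lin R.
  have h3 : q * (e / 2) <= e / 2 by rewrite ler_piMl ?ltW.
  by apply: le_trans (ler_normB _ _) _; lra.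
exists u; split => // psi e e0.
have [c' c'0 Hc'] := BUC_dist_bounded psi u.
have [N HN] := @expr_small _ q c' e q0 q1 e0.
exists N => n Nn t; apply: le_trans (HN n Nn); move: t.
elim: n {Nn} => [|n IH] t; first by rewrite mulr1.
rewrite -[u t]Tu exprS mulrCA; exact: HT.
Qed.

(** * Approximation by Yosida means *)

Lemma yosida_mean_approx (R : realType) (X : completeNormedModType R)
    (u : BUC X) (e : R) : 0 < e -> exists2 delta : R, 0 < delta &
  forall lambda : R, 0 < lambda -> lambda <= delta ->
    unif_dist_le (yosida_mean lambda u) u e.
Proof.
move=> e0; have [|C C0 HC] := BUC_unif_small u (_ : 0 < e / 2); first lra.
have C10 : 0 < C + 1 by lra.
exists (e / 2 / (C + 1)); first by rewrite !divr_gt0.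
move=> lambda l0 ld t.
have := @yosida_mean_dist_poly R lambda l0 X u t (u t) (e / 2) C 0.
rewrite mulr0 mul0r !addr0 => H; apply: le_trans (H _) _.
  move=> tau tau0; rewrite mul0r addr0; apply: le_trans (HC _ _) _.
  by rewrite addrAC subrr add0r normrN ger0_norm.
have : C * lambda <= (C + 1) * (e / 2 / (C + 1)).
  by apply: ler_pM => //; [exact: ltW|lra].
have -> : (C + 1) * (e / 2 / (C + 1)) = e / 2 by field; exact: lt0r_neq0.
lra.
Qed.

(** By [yosida_mean_shift] the mean relaxes towards [u s] at rate [1 / lambda]; the pull towards
    [u s] and the oscillation of [u] contribute [2 * M] each. *)
Lemma yosida_mean_lipschitz (R : realType) (X : completeNormedModType R)
    (lambda M : R) (u : BUC X) : 0 < lambda -> (forall t, `|u t| <= M) ->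
  forall t s,
    `|yosida_mean lambda u t - yosida_mean lambda u s| <= 4 * M / lambda * `|t - s|.
Proof.
move=> l0 HM t s; wlog st : t s / s <= t => [H|].
  have [|/ltW ts] := leP s t; first exact: H.
  by rewrite distrC (distrC t); exact: H.
have M0 : 0 <= M by apply: le_trans (HM 0).
have HJ : `|yosida_mean lambda u s| <= M.
  have := @yosida_mean_dist_poly R lambda l0 X u s 0 M 0 0.
  rewrite mulr0 !mul0r !addr0 subr0; apply => tau _.
  by rewrite !mul0r !addr0 subr0.
have ts0 : 0 <= t - s by rewrite subr_ge0.
have Hosc (r : R) : s <= r -> r <= s + (t - s) -> `|u r - u s| <= M + M.
  by move=> _ _; apply: le_trans (ler_normB _ _) _; exact: lerD.
have := yosida_mean_shift l0 ts0 Hosc.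
rewrite (addrC s) subrK; set E := expR _ => h1.
have E1 : 0 <= 1 - E.
  rewrite subr_ge0 /E -expR0 ler_expR mulNr oppr_le0 divr_ge0//; exact: ltW.
have E2 : 1 - E <= (t - s) / lambda.
  have : 1 + - (t - s) / lambda <= E by exact: expR_ge1Dx.
  by rewrite mulNr; lra.
have -> : yosida_mean lambda u t - yosida_mean lambda u s =
  (yosida_mean lambda u t - (E *: yosida_mean lambda u s + (1 - E) *: u s)) +
  (1 - E) *: (u s - yosida_mean lambda u s) by lin R.
apply: le_trans (ler_normD _ _) _; rewrite normrZ (ger0_norm E1) (ger0_norm ts0).
have h2 : (1 - E) * `|u s - yosida_mean lambda u s| <= (1 - E) * (M + M).
  by apply: ler_wpM2l => //; apply: le_trans (ler_normB _ _) _; exact: lerD.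
have M40 : 0 <= 4 * M by rewrite mulr_ge0.
have h3 := ler_wpM2r M40 E2.
have -> : 4 * M / lambda * (t - s) = (t - s) / lambda * (4 * M) by ring.
lra.
Qed.

Lemma klipschitzP (R : realType) (X : normedModType R) (f : R -> X) (k : R) :
  k.-lipschitz f <-> forall t s, `|f t - f s| <= k * `|t - s|.
Proof.
split=> [H t s|H [t s] _]; first exact: (H (t, s)).
exact: H.
Qed.

Lemma BUC_lipschitz_dense (R : realType) (X : completeNormedModType R)
    (u : BUC X) (e : R) : 0 < e -> exists2 v : BUC X, unif_dist_le u v e &
  exists2 L : R, 0 <= L & L.-lipschitz v.
Proof.
move=> e0; have [l l0 Hl] := yosida_mean_approx u e0.
have [M M0 HM] := BUC_bounded u.
exists (MkBUC (yosida_mean_BUC l0 u)).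
  by move=> t; rewrite distrC; exact: Hl.
exists (4 * M / l); first by rewrite divr_ge0 ?(ltW l0)// mulr_ge0.
by apply/klipschitzP => t s; exact: yosida_mean_lipschitz.
Qed.

Lemma uniform_cvgP (R : realType) (X : normedModType R) (T : Type)
    (F : set_system T) {FF : Filter F} (f : T -> R -> X) (l : R -> X) :
  {uniform, f @ F --> l} <->
  forall e : R, 0 < e -> \forall x \near F, unif_dist_le (f x) l e.
Proof.
split=> [H e e0|H P /uniform_nbhs[E [entE EP]]].
  suff /H : nbhs (l : {uniform R -> X}) [set v : R -> X | unif_dist_le v l e].
    by [].
  apply/uniform_nbhs; exists [set xy : X * X | ball xy.1 e xy.2].
  split; first by rewrite -entourage_ballE; exists e.
  move=> v /= Hv t; have := Hv t I; rewrite -ball_normE /ball_ /= distrC.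
  exact: ltW.
have : entourage E by [].
rewrite -entourage_ballE => -[e /= e0 eE].
have e20 : 0 < e / 2 by lra.
have := H _ e20; apply: filterS => x Hx; apply: EP => t _; apply: eE => /=.
rewrite -ball_normE /ball_ /= distrC; apply: le_lt_trans (Hx t) _; lra.
Qed.

Lemma uniform_cvg_unique (R : realType) (X : normedModType R) (T : Type)
    (F : set_system T) {FF : ProperFilter F} (f : T -> R -> X) (l l' : R -> X) :
  {uniform, f @ F --> l} -> {uniform, f @ F --> l'} -> forall t, l t = l' t.
Proof.
move=> /uniform_cvgP H /uniform_cvgP H' t.
apply/eqP; rewrite -subr_eq0 -normr_le0; apply/ler_addgt0Pr => e e0.
rewrite add0r; have e20 : 0 < e / 2 by lra.
near F => x.
have h1 : unif_dist_le (f x) l (e / 2) by near: x; exact: H.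
have h2 : unif_dist_le (f x) l' (e / 2) by near: x; exact: H'.
have -> : l t - l' t = (f x t - l' t) - (f x t - l t) by lin R.
by apply: le_trans (ler_normB _ _) _; have := h1 t; have := h2 t; lra.
Unshelve. all: end_near. Qed.

Lemma bounded_unif_continuous_continuous (R : realType) (X : normedModType R)
    (f : R -> X) : bounded_unif_continuous f -> continuous f.
Proof.
move=> fP t; apply/cvgrPdist_le => e e0.
have [d d0 Hd] := BUC_uc (MkBUC fP) e0.
by exists d => //= s; exact: Hd.
Qed.

Lemma lipschitzP (R : realType) (X : normedModType R) (f : R -> X) :
  lipschitz f -> exists2 k : R, 0 <= k & k.-lipschitz f.
Proof.
move=> H; near +oo_R => k; exists k; near: k; last exact: H.
exact: nbhs_pinfty_ge.
Unshelve. all: end_near. Qed.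

Lemma bounded_lipschitz_BUC (R : realType) (X : normedModType R) (f : R -> X) :
  bounded_lipschitz f -> bounded_unif_continuous f.
Proof.
move=> [fb /lipschitzP[k k0 /klipschitzP fk]]; have [M [_ HM]] := fb.
apply: (@unif_small_BUC _ _ _ (`|M| + 1)).
  by move=> t; apply: HM => //; rewrite (le_lt_trans (ler_norm M))// ltrDl.
exact: unif_small_le fk (unif_smallZ k0 (@unif_small_dist R)).
Qed.

(** * Histories and the shift by [omega] *)

Lemma delay_itv_point (R : realType) (d : delay R) : delay_itv d.
Proof.
exists 0; rewrite inE; case: d => [|r] /=; rewrite in_itv/= lexx ?andbT//.
Qed.

Lemma sup_norm_segment_le (R : realType) (X : normedModType R) (d : delay R)
    (phi : BUC X) (t M : R) : (forall s, `|phi s| <= M) ->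
  sup_norm (@segment R X d phi t) <= M.
Proof. by move=> HM; apply: (sup_norm_le (delay_itv_point d)) => s; exact: HM. Qed.

Lemma sup_norm_segmentB_le (R : realType) (X : normedModType R) (d : delay R)
    (phi psi : BUC X) (t s c : R) :
    (forall r, `|phi (t + r) - psi (s + r)| <= c) ->
  sup_norm (fun r => @segment R X d phi t r - segment psi s r) <= c.
Proof. by move=> Hc; apply: (sup_norm_le (delay_itv_point d)) => r; exact: Hc. Qed.

Lemma sup_norm_ge0 (R : realType) (X : normedModType R) (T : Type)
    (f : T -> X) (c : R) : (forall s, `|f s| <= c) -> 0 <= sup_norm f.
Proof.
move=> fc; have [t|T0] := pselect (inhabited T).
  by have [s] := t; apply: le_trans (le_sup_norm s fc).
have -> : f = fun=> 0 by apply/funext => s; case: T0.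
rewrite /sup_norm (_ : range _ = set0) ?sup0// -subset0 => x [s _ _].
by case: T0.
Qed.

(* Subtracting [omega] from a dissipative operator gains the factor
   [1 - a omega]: use the hypothesis with [lambda = a/(1 - a omega)]. *)
Lemma control_shift (R : realType) (X : normedModType R) (omega a E : R)
    (x1 y1 x2 y2 : X) : omega < 0 -> 0 < a ->
    (forall lambda : R, 0 < lambda ->
       `|x1 - x2| <= `|x1 - x2 - lambda *: (y1 - y2)| + lambda * E) ->
  (1 - a * omega) * `|x1 - x2| <=
    `|x1 - x2 - a *: ((y1 + omega *: x1) - (y2 + omega *: x2))| + a * E.
Proof.
move=> om a0 H; set p := 1 - a * omega.
have p0 : 0 < p by rewrite /p; nra.
have pn : p != 0 by rewrite lt0r_neq0.
have l0 : 0 < a / p by rewrite divr_gt0.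
have := ler_wpM2l (ltW p0) (H _ l0).
have -> : p * (`|x1 - x2 - (a / p) *: (y1 - y2)| + a / p * E) =
    `|p *: (x1 - x2 - (a / p) *: (y1 - y2))| + a * E.
  by rewrite normrZ gtr0_norm//; field.
congr (_ <= `|_| + _).
have -> : p *: (x1 - x2 - (a / p) *: (y1 - y2)) = p *: (x1 - x2) - a *: (y1 - y2).
  by lin_eq R; field.
by rewrite /p; lin R.
Qed.

(** * The Banach space of bounded functions *)

Section bounded_functions.
Variables (T : Type) (R : realType) (X : normedModType R).

Definition bounded_pred : {pred T -> X} :=
  fun f => `[< exists M : R, forall t, `|f t| <= M >].

Lemma bounded_pred_submod : submod_closed bounded_pred.
Proof.
split=> [|a f g /asboolP[M HM] /asboolP[N HN]]; apply/asboolP.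
  by exists 0 => t; rewrite normr0.
exists (`|a| * M + N) => t; apply: le_trans (ler_normD _ _) _.
by apply: lerD => //; rewrite normrZ ler_wpM2l.
Qed.

HB.instance Definition _ :=
  GRing.isSubmodClosed.Build R (T -> X) bounded_pred bounded_pred_submod.

Record bounded_function := BoundedFunction {
  bounded_val :> T -> X;
  bounded_valP : bounded_val \in bounded_pred }.

HB.instance Definition _ := [isSub for bounded_val].
HB.instance Definition _ := [Choice of bounded_function by <:].
HB.instance Definition _ := [SubChoice_isSubLmodule of bounded_function by <:].

Implicit Types f g : bounded_function.

Lemma bounded_functionP f : exists M : R, forall t, `|f t| <= M.
Proof. exact/asboolP/(bounded_valP f). Qed.

Lemma bounded_norm_le f (c : R) : 0 <= c -> (forall t, `|f t| <= c) ->
  sup_norm f <= c.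
Proof.
move=> c0 fc; have [[t]|T0] := pselect (inhabited T).
  exact: sup_norm_le.
suff r0 : range (fun s => `|f s|) = set0 by rewrite /sup_norm r0 sup0.
by rewrite -subset0 => x [s _ _]; case: T0.
Qed.

Lemma le_bounded_norm f t : `|f t| <= sup_norm f.
Proof. by have [M HM] := bounded_functionP f; exact: le_sup_norm HM. Qed.

Lemma bounded_norm_ge0 f : 0 <= sup_norm f.
Proof. by have [M HM] := bounded_functionP f; exact: sup_norm_ge0 HM. Qed.

Lemma bounded_normD f g : sup_norm (f + g) <= sup_norm f + sup_norm g.
Proof.
apply: bounded_norm_le => [|t]; first by rewrite addr_ge0// bounded_norm_ge0.
by apply: le_trans (ler_normD _ _) _; apply: lerD; exact: le_bounded_norm.
Qed.

Lemma bounded_normZ_le (l : R) f : sup_norm (l *: f) <= `|l| * sup_norm f.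
Proof.
apply: bounded_norm_le => [|t]; first by rewrite mulr_ge0// bounded_norm_ge0.
by rewrite /= normrZ ler_wpM2l// le_bounded_norm.
Qed.

Lemma bounded_normZ (l : R) f : sup_norm (l *: f) = `|l| * sup_norm f.
Proof.
apply/eqP; rewrite eq_le bounded_normZ_le andTb.
have [->|l0] := eqVneq l 0; first by rewrite normr0 mul0r bounded_norm_ge0.
rewrite -ler_pdivlMl ?normr_gt0// -normfV.
have {1}-> : f = l^-1 *: (l *: f) by rewrite scalerA mulVf// scale1r.
exact: bounded_normZ_le.
Qed.

Lemma bounded_norm_eq0 f : sup_norm f = 0 -> f = 0.
Proof.
move=> f0; apply/val_inj/funext => t /=; apply/eqP.
by rewrite -normr_le0 -f0 le_bounded_norm.
Qed.

HB.instance Definition _ := Lmodule_isNormed.Build R bounded_function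
  bounded_normD bounded_normZ bounded_norm_eq0.

Lemma bounded_function_normE f : `|f| = sup_norm f. Proof. by []. Qed.

End bounded_functions.

Section bounded_functions_complete.
Variables (T : Type) (R : realType) (X : completeNormedModType R).

Lemma bounded_function_complete (F : set_system (bounded_function T X)) :
  ProperFilter F -> cauchy F -> cvg F.
Proof.
move=> FF /cauchy_ballP Fc.
have Fc' (e : R) : 0 < e -> exists2 P : set (bounded_function T X), F P &
    forall f g, P f -> P g -> `|f - g| < e.
  move=> e0; have [[P Q] /= [FP FQ] PQ] := Fc e e0.
  exists (P `&` Q); first exact: filterI.
  move=> f g [Pf Qf] [Pg Qg]; have := PQ (f, g) (conj Pf Qg).
  by rewrite -ball_normE.
have Ft t : exists l : X, (fun f : bounded_function T X => f t) @ F --> l.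
  apply/cvg_ex/cauchy_cvgP/cauchy_exP => e e0.
  have [P FP HP] := Fc' e e0; have [f Pf] := filter_ex FP.
  exists (f t); suff : \forall g \near F, ball (f t) e (bounded_val g t) by [].
  apply: filterS FP => g Pg /=.
  rewrite -ball_normE /ball_ /=; apply: le_lt_trans (HP f g Pf Pg).
  exact: (le_bounded_norm (f - g)).
have {Ft} [l Hl] := choice Ft.
have Hd (e : R) : 0 < e -> exists2 P : set (bounded_function T X), F P &
    forall f, P f -> forall t, `|f t - l t| <= e.
  move=> e0; have [P FP HP] := Fc' e e0; exists P => // f Pf t.
  rewrite distrC; apply: (lim_norm_le (Hl t)).
  apply: filterS FP => g Pg; apply: ltW; apply: le_lt_trans (HP g f Pg Pf).
  exact: (le_bounded_norm (g - f)).
have lb : (l : T -> X) \in @bounded_pred T R X.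
  have [P FP HP] := Hd 1 ltr01; have [f Pf] := filter_ex FP.
  have [M HM] := bounded_functionP f; apply/asboolP; exists (M + 1) => t.
  have -> : l t = f t - (f t - l t) by lin R.
  by apply: le_trans (ler_normB _ _) _; apply: lerD => //; exact: HP.
apply/cvg_ex; exists (BoundedFunction lb).
apply/cvgrPdist_le => e e0; have [P FP HP] := Hd e e0.
apply: filterS FP => f Pf; rewrite distrC bounded_function_normE.
by apply: bounded_norm_le => [|t]; [exact: ltW|exact: HP].
Qed.

HB.instance Definition _ :=
  Uniform_isComplete.Build (bounded_function T X) bounded_function_complete.

End bounded_functions_complete.

(** * From local increments to integrals *)

Section integral_inequality.
Variables (R : realType).
Local Notation mu := (@lebesgue_measure R).

Lemma continuous_integrable_itv (q : R -> R) (r t : R) : continuous q ->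
  mu.-integrable `[r, t] (EFin \o q).
Proof.
move=> cq; apply: continuous_compact_integrable; first exact: segment_compact.
exact: continuous_subspaceT.
Qed.

Lemma Rintegral_increment_ge (q : R -> R) (r x y c : R) : continuous q ->
    r <= x -> x <= y -> (forall z, x <= z -> z <= y -> c <= q z) ->
  (y - x) * c <= \int[mu]_(z in `[r, y]) q z - \int[mu]_(z in `[r, x]) q z.
Proof.
move=> cq rx xy cle.
have iq a b := @continuous_integrable_itv q a b cq.
rewrite Rintegral_itvB; [|exact: iq|by rewrite bnd_simp|by rewrite bnd_simp].
have -> : (y - x) * c = \int[mu]_(_ in `]x, y]) c.
  rewrite Rintegral_cst//= lebesgue_measure_itv/= lte_fin mulrC.
  have [//|yx] := ltP x y; have -> : y = x by apply/eqP; rewrite eq_le xy yx.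
  by rewrite subrr.
have ss : `]x, y] `<=` `[x, y].
  by move=> z /=; rewrite !in_itv/= => /andP[/ltW -> ->].
apply: le_Rintegral => //.
- apply: (@integrableS _ _ _ mu `[x, y]) => //.
  by apply: (@continuous_integrable_itv (fun=> c)) => ?; exact: cvg_cst.
- exact: (@integrableS _ _ _ mu `[x, y]).
- by move=> z /=; rewrite in_itv/= => /andP[/ltW xz zy]; exact: cle.
Qed.

(** On a short interval [(y - x) * q x] exceeds the integral of [q] by at most [e * (y - x)]; with
    the error already in the hypothesis this makes [2 * e], and the resulting relation chains. *)
Lemma increment_le_Rintegral (W q : R -> R) (r t e delta : R) : continuous q ->
    0 < delta -> r <= t ->
    (forall x y, x <= y -> y - x < delta -> W y - W x <= (y - x) * (q x + e)) ->
    (forall x y, `|x - y| < delta -> `|q x - q y| <= e) ->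
  W t - W r <= \int[mu]_(z in `[r, t]) q z + 2 * e * (t - r).
Proof.
move=> cq d0 rt HW Hq.
pose I x := \int[mu]_(z in `[r, x]) q z.
have -> : \int[mu]_(z in `[r, t]) q z = I t - I r.
  by rewrite /I set_itv1 Rintegral_set1 subr0.
apply: (@interval_chain _ (fun x y =>
  W y - W x <= I y - I x + 2 * e * (y - x)) r _ d0) => //.
  by move=> x z y _ _ _; lra.
move=> x y rx xy yx; have h1 := HW x y xy yx.
have : (y - x) * (q x - e) <= I y - I x.
  apply: Rintegral_increment_ge => // z xz zy.
  have : `|q x - q z| <= e.
    by apply: Hq; rewrite distrC ger0_norm ?subr_ge0//; lra.
  by move/ler_normlP => [_]; lra.
by move: h1; rewrite !mulrDr mulrN; lra.
Qed.

(** The quadratic bound comes from [expR (- x) * (1 + x) <= 1]. *)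
Lemma expR_quadratic (x : R) : 0 <= x ->
  0 <= 1 - expR (- x) <= x /\ x - (1 - expR (- x)) <= x ^+ 2.
Proof.
move=> x0; have h1 : 1 - x <= expR (- x) by exact: expR_ge1Dx.
have h2 : expR (- x) <= 1 by rewrite -expR0 ler_expR oppr_le0.
have h3 : expR (- x) * (1 + x) <= 1.
  have : expR (- x) * (1 + x) <= expR (- x) * expR x.
    by apply: ler_wpM2l (expR_ge1Dx x); exact: expR_ge0.
  by rewrite -expRD addNr expR0.
split; first by apply/andP; split; lra.
have h4 := expR_ge0 (- x); nra.
Qed.

End integral_inequality.

(** * Difference quotients of the norm *)

Section bracket.
Variables (R : realType) (X : normedModType R) (y : X).

Definition diff_quotient (x : X) (a : R) : R := a^-1 * (`|x + a *: y| - `|x|).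

Lemma diff_quotient_le (x : X) (a : R) : 0 < a -> diff_quotient x a <= `|y|.
Proof.
move=> a0; rewrite /diff_quotient ler_pdivrMl//.
have := ler_normD x (a *: y); rewrite normrZ gtr0_norm//; lra.
Qed.

Lemma diff_quotient_ge (x : X) (a : R) : 0 < a -> - `|y| <= diff_quotient x a.
Proof.
move=> a0; rewrite /diff_quotient ler_pdivlMl//.
have := ler_normB (x + a *: y) (a *: y); rewrite addrK normrZ gtr0_norm//; lra.
Qed.

(** Convexity of the norm: [x + a *: y] lies between [x] and [x + b *: y]. *)
Lemma diff_quotient_mono (x : X) (a b : R) : 0 < a -> a <= b ->
  diff_quotient x a <= diff_quotient x b.
Proof.
move=> a0 ab; have b0 : 0 < b by exact: lt_le_trans ab.
rewrite /diff_quotient ler_pdivrMl//.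
have -> : x + a *: y = (1 - a / b) *: x + (a / b) *: (x + b *: y).
  by lin_eq R; field; exact: lt0r_neq0.
have t0 : 0 <= a / b by rewrite divr_ge0 ?ltW.
have t1 : 0 <= 1 - a / b by rewrite subr_ge0 ler_pdivrMr ?mul1r.
have := ler_normD ((1 - a / b) *: x) ((a / b) *: (x + b *: y)).
rewrite normrZ (ger0_norm t1) normrZ (ger0_norm t0).
have -> : a * (b^-1 * (`|x + b *: y| - `|x|)) =
  a / b * `|x + b *: y| - a / b * `|x| by ring.
lra.
Qed.

(** Monotone quotients bounded below converge, so the [lim] in [bracket_plus] is a true limit. A
    sequence of steps is taken in view of dominated convergence. *)
Lemma bracket_plus_cvg (x : X) :
  (fun n => diff_quotient x n.+1%:R^-1) @ \oo --> bracket_plus y x.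
Proof.
have cvg0 : diff_quotient x @ 0^'+ --> bracket_plus y x.
  apply: nondecreasing_at_right_is_cvgr.
    near=> b => a c; rewrite !in_itv/= => /andP[a0 _] _; exact: diff_quotient_mono.
  near=> b; exists (- `|y|) => _ [a /= + <-]; rewrite in_itv/= => /andP[a0 _].
  exact: diff_quotient_ge.
move/cvg_at_rightP : cvg0; apply; split=> [n|]; first by rewrite invr_gt0.
apply/cvgrPdist_le => e e0; have [N HN] := small_inv e0.
exists N => // n /= Nn; rewrite sub0r normrN ger0_norm ?invr_ge0//.
by apply: ltW; exact: HN.
Unshelve. all: end_near. Qed.

End bracket.

(** * The integral inequality for a limit of approximate solutions *)

Section integral_solutions.
Variables (R : realType) (X : completeNormedModType R) (Z : normedModType R).
Variables (B : R -> set (X * X)) (omega : R).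
Variables (hB : R -> Z) (LB : R -> R) (g : R -> X) (u : BUC X).
Hypothesis omega_lt0 : omega < 0.
Hypothesis B_control : operator_control B hB LB g.
Hypothesis u_limit : forall e : R, 0 < e -> exists2 delta : R, 0 < delta &
  forall lambda : R, 0 < lambda -> lambda < delta -> exists2 v : BUC X,
    (forall t, B t (v t, yosida_derivative lambda v t - omega *: v t)) &
    unif_dist_le v u e.
Local Notation mu := (@lebesgue_measure R).

Let dist_err (r : R) (x y0 : X) (nu : R) :=
  `|hB nu - hB r| * LB `|x| + `|g nu - g r| * `|y0|.

(** With [1 / a = 1 / lambda + 1 / b], the vector in the control condition is a convex combination
    of [v nu - x + b *: y] and [yosida_mean lambda v nu - x]. Multiplying by [(lambda + b) / b]
    isolates the quotient of step [b]. *)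
Let defect_le (lambda b r nu : R) (v : BUC X) (x y0 : X) :
    0 < lambda -> 0 < b ->
    (forall t, B t (v t, yosida_derivative lambda v t - omega *: v t)) ->
    B r (x, y0) ->
  `|v nu - x| - `|yosida_mean lambda v nu - x| <= lambda *
    (diff_quotient (y0 + omega *: x) (v nu - x) b + omega * `|v nu - x| +
     dist_err r x y0 nu).
Proof.
move=> l0 b0 Bv Br; set y := y0 + omega *: x.
have lb0 : 0 < lambda + b by rewrite addr_gt0.
pose a := b * lambda / (lambda + b).
have a0 : 0 < a by rewrite divr_gt0// mulr_gt0.
have [_ _ _ ctl] := B_control.
have ctl' (l : R) : 0 < l -> `|v nu - x| <=
    `|v nu - x - l *: (yosida_derivative lambda v nu - omega *: v nu - y0)| +
    l * dist_err r x y0 nu.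
  move=> l0'; apply: le_trans (ctl l nu r _ _ _ _ l0' (Bv nu) Br) _.
  by rewrite /dist_err; lra.
have := control_shift omega_lt0 a0 ctl'; rewrite subrK -/y.
rewrite /yosida_derivative -/(yosida_mean lambda v nu).
have ln := lt0r_neq0 l0; have bn := lt0r_neq0 b0; have lbn := lt0r_neq0 lb0.
have -> : v nu - x - a *: (lambda^-1 *: (v nu - yosida_mean lambda v nu) - y) =
    (lambda / (lambda + b)) *: (v nu - x + b *: y) +
    (b / (lambda + b)) *: (yosida_mean lambda v nu - x).
  by rewrite /a; lin_eq R; field; rewrite ?ln ?lbn.
set P := `|v nu - x|; set W := `|yosida_mean lambda v nu - x|.
set D := dist_err _ _ _ _; move=> H1.
have := ler_normD ((lambda / (lambda + b)) *: (v nu - x + b *: y))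
  ((b / (lambda + b)) *: (yosida_mean lambda v nu - x)).
have c1 : 0 <= lambda / (lambda + b) by rewrite divr_ge0 ?ltW.
have c2 : 0 <= b / (lambda + b) by rewrite divr_ge0 ?ltW.
rewrite normrZ (ger0_norm c1) normrZ (ger0_norm c2) -/W => H2.
rewrite /diff_quotient -/P.
have H3 : (1 - a * omega) * P <= lambda / (lambda + b) * `|v nu - x + b *: y| +
    b / (lambda + b) * W + a * D by lra.
have k0 : 0 < (lambda + b) / b by rewrite divr_gt0.
have := ler_wpM2l (ltW k0) H3; rewrite -subr_ge0 => H4.
rewrite -subr_ge0; congr (0 <= _) : H4; rewrite /a; field.
by rewrite ?bn ?lbn.
Qed.

Let quotient_inequality (b r t : R) (x y0 : X) : 0 < b -> r <= t -> B r (x, y0) ->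
  `|u t - x| - `|u r - x| <= \int[mu]_(nu in `[r, t])
    (diff_quotient (y0 + omega *: x) (u nu - x) b + omega * `|u nu - x| +
     dist_err r x y0 nu).
Proof.
move=> b0 rt Br; set y := y0 + omega *: x.
pose q nu := diff_quotient y (u nu - x) b + omega * `|u nu - x| +
  dist_err r x y0 nu.
have [hB_BUC [LB_ge0 _ _] /bounded_lipschitz_BUC g_BUC _] := B_control.
(* A Lipschitz constant of the quotient of step [b] plus [omega] times the norm; it blows up as [b]
   tends to 0, which is why [b] is fixed here. *)
pose c1 := 2 / b + `|omega|.
have c10 : 0 <= c1 by rewrite addr_ge0// divr_ge0// ltW.
have dq_lip (v1 v2 : X) :
    diff_quotient y v1 b + omega * `|v1| <=
    diff_quotient y v2 b + omega * `|v2| + c1 * `|v1 - v2|.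
  have h1 := ler_normD (v2 + b *: y) (v1 - v2).
  have h2 := ler_normD v1 (v2 - v1).
  rewrite addrC subrK distrC in h2.
  have h3 := ler_normD v2 (v1 - v2); rewrite addrC subrK in h3.
  have E1 : v2 + b *: y + (v1 - v2) = v1 + b *: y by lin R.
  rewrite E1 in h1.
  have h4 : omega * `|v1| - omega * `|v2| <= `|omega| * `|v1 - v2|.
    rewrite -mulrBr; apply: le_trans (ler_norm _) _; rewrite normrM.
    by apply: ler_wpM2l => //; exact: ler_dist_dist.
  have bi : 0 <= b^-1 by rewrite invr_ge0 ltW.
  have h5 : `|v1 + b *: y| - `|v1| <= `|v2 + b *: y| - `|v2| + 2 * `|v1 - v2|.
    by lra.
  have := ler_wpM2l bi h5; rewrite /diff_quotient /c1 mulrDr mulrDl; lra.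
have q_inc t' s' : `|q t' - q s'| <= c1 * `|u t' - u s'| +
    LB `|x| * `|hB t' - hB s'| + `|y0| * `|g t' - g s'|.
  have q_le a c : q a - q c <= c1 * `|u a - u c| +
      LB `|x| * `|hB a - hB c| + `|y0| * `|g a - g c|.
    have h1 := dq_lip (u a - x) (u c - x).
    rewrite opprB addrA subrK in h1.
    have h2 : `|hB a - hB r| <= `|hB c - hB r| + `|hB a - hB c|.
      by have := ler_normD (hB c - hB r) (hB a - hB c);
         rewrite addrC addrA subrK addrC.
    have h3 : `|g a - g r| <= `|g c - g r| + `|g a - g c|.
      by have := ler_normD (g c - g r) (g a - g c);
         rewrite addrC addrA subrK addrC.
    have := ler_wpM2r (LB_ge0 _ (normr_ge0 x)) h2.
    have := ler_wpM2r (normr_ge0 y0) h3.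
    rewrite /q /dist_err; lra.
  rewrite ler_norml q_le andbT lerNl opprB; apply: le_trans (q_le _ _) _.
  by rewrite (distrC (u s')) (distrC (hB s')) (distrC (g s')).
have q_BUC : bounded_unif_continuous q.
  have Lx0 := LB_ge0 _ (normr_ge0 x).
  have [Mu Mu0 HMu] := BUC_bounded u.
  have [Mh Mh0 HMh] := BUC_bounded (MkBUC hB_BUC).
  have [Mg Mg0 HMg] := BUC_bounded (MkBUC g_BUC).
  apply: (@unif_small_BUC _ _ _ (`|q 0| + (c1 * (Mu + Mu) +
    LB `|x| * (Mh + Mh) + `|y0| * (Mg + Mg)))).
    move=> s; have -> : q s = q 0 + (q s - q 0) by rewrite addrC subrK.
    apply: le_trans (ler_normD _ _) _; rewrite lerD2l.
    apply: le_trans (q_inc _ _) _.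
    apply: lerD; [apply: lerD|]; apply: ler_wpM2l => //;
      apply: le_trans (ler_normB _ _) _; exact: lerD.
  apply: unif_small_le q_inc _; apply: unif_smallD; [apply: unif_smallD|].
  - exact: unif_smallZ c10 (BUC_unif_small u).
  - exact: unif_smallZ Lx0 (BUC_unif_small (MkBUC hB_BUC)).
  - exact: unif_smallZ (normr_ge0 y0) (BUC_unif_small (MkBUC g_BUC)).
have cq : continuous q by exact: bounded_unif_continuous_continuous q_BUC.
have [Mq Mq0 HMq] := BUC_bounded (MkBUC q_BUC).
apply/ler_addgt0Pr => e e0.
have k0 : 0 < 2 * (c1 + 2) * (t - r) + 4.
  by rewrite ltr_wpDl// mulr_ge0 ?subr_ge0// mulr_ge0// addr_ge0.
(* The total error is [2 * ((c1 + 2) * eta) * (t - r)] from the integration and [2 * eta] at each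
   end from replacing [W] by the norm of [u - x]. *)
pose eta := e / (2 * (c1 + 2) * (t - r) + 4).
have eta0 : 0 < eta by rewrite divr_gt0.
have [d1 d10 H1] := yosida_mean_approx u eta0.
have [d2 d20 H2] := u_limit eta0.
pose lambda := Num.min d1 d2 / 2.
have m0 : 0 < Num.min d1 d2 by rewrite lt_min d10.
have l0 : 0 < lambda by rewrite divr_gt0.
have lm : lambda < Num.min d1 d2 by rewrite /lambda; lra.
have /andP[ld1 ld2] : (lambda < d1) && (lambda < d2) by rewrite -lt_min.
have [v Bv vu] := H2 _ l0 ld2.
pose W s := `|yosida_mean lambda v s - x|.
have Wu s : `|W s - `|u s - x| | <= 2 * eta.
  apply: le_trans (ler_dist_dist _ _) _.
  have -> : yosida_mean lambda v s - x - (u s - x) =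
    (yosida_mean lambda v s - yosida_mean lambda u s) +
    (yosida_mean lambda u s - u s) by lin R.
  apply: le_trans (ler_normD _ _) _.
  have h1 : `|yosida_mean lambda v s - yosida_mean lambda u s| <= eta.
    by apply: yosida_mean_dist => // tau _; exact: vu.
  by have := H1 _ l0 (ltW ld1) s; lra.
have le0 : 0 < lambda * eta by rewrite mulr_gt0.
have e10 : 0 < (c1 + 2) * eta by rewrite mulr_gt0//; lra.
have [dv dv0 Hv] := BUC_uc v le0.
have [dq dq0 Hq] := BUC_uc (MkBUC q_BUC) e10.
(* [Qm] bounds the rate [Q] below. The third constraint on [delta] makes the second-order remainder
   of the exponential at most [eta] per unit length; [delta] may depend on [lambda] and [v], both
   already fixed. *)
pose Qm := Mq + c1 * eta + eta.
have Qm0 : 0 < Qm by rewrite ltr_wpDl// addr_ge0// mulr_ge0// ltW.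
pose delta := Num.min (Num.min dv dq) (lambda * eta / Qm).
have delta0 : 0 < delta by rewrite !lt_min dv0 dq0 divr_gt0.
(* Of the error [(c1 + 2) * eta], the part [c1 * eta] comes from replacing [v] by [u], one [eta]
   from the oscillation of [v], and one from the exponential remainder. *)
have HW x' y' : x' <= y' -> y' - x' < delta ->
    W y' - W x' <= (y' - x') * (q x' + (c1 + 2) * eta).
  move=> xy; rewrite !lt_min => /andP[/andP[xyv _] xyQ].
  have s0 : 0 <= y' - x' by rewrite subr_ge0.
  have osc z : x' <= z -> z <= x' + (y' - x') -> `|v z - v x'| <= lambda * eta.
    move=> xz zy; apply: Hv; rewrite ger0_norm ?subr_ge0//; lra.
  have := yosida_mean_shift l0 s0 osc; rewrite (addrC x') subrK.
  have z0 : 0 <= (y' - x') / lambda by rewrite divr_ge0// ltW.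
  have := expR_quadratic z0; rewrite -mulNr; set E := expR _.
  move=> [/andP[E0 E1] E2] shift.
  have E3 : 0 <= E by exact: expR_ge0.
  pose P := `|v x' - x|.
  have h1 : W y' <= E * W x' + (1 - E) * P + (1 - E) * (lambda * eta).
    have -> : E * W x' = `|E *: (yosida_mean lambda v x' - x)|.
      by rewrite normrZ ger0_norm.
    have -> : (1 - E) * P = `|(1 - E) *: (v x' - x)|.
      by rewrite normrZ ger0_norm.
    have -> : W y' = `|E *: (yosida_mean lambda v x' - x) +
        (1 - E) *: (v x' - x) + (yosida_mean lambda v y' -
        (E *: yosida_mean lambda v x' + (1 - E) *: v x'))|.
      by rewrite /W; congr `|_|; lin R.
    apply: le_trans (ler_normD _ _) _; apply: lerD => //; exact: ler_normD.
  have h2 := defect_le x' l0 b0 Bv Br.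
  pose Q := q x' + c1 * eta + eta.
  have h3 : P - W x' + lambda * eta <= lambda * Q.
    apply: (@le_trans _ _ (lambda * (q x' + c1 * eta) + lambda * eta)).
      rewrite lerD2r; apply: le_trans h2 _; apply: ler_wpM2l; first exact: ltW.
      have := dq_lip (v x' - x) (u x' - x); rewrite opprB addrA subrK.
      have := ler_wpM2l c10 (vu x'); rewrite /q -/y; lra.
    by rewrite /Q; lra.
  have h4 : `|Q| <= Qm.
    rewrite /Q /Qm; apply: le_trans (ler_normD _ _) _.
    rewrite [leRHS]addrC -[leRHS]addrC (gtr0_norm eta0) lerD2r.
    apply: le_trans (ler_normD _ _) _; apply: lerD; first exact: HMq.
    by rewrite ger0_norm// mulr_ge0// ltW.
  have h5 : W y' - W x' <= (1 - E) * (lambda * Q).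
    apply: le_trans (ler_wpM2l E0 h3); move: h1; rewrite /P; lra.
  have ln := lt0r_neq0 l0.
  have h6 : (y' - x') / lambda * Qm <= eta.
    rewrite mulrAC ler_pdivrMr// [leRHS]mulrC -ler_pdivlMr//; exact: ltW.
  apply: le_trans h5 _.
  have -> : (1 - E) * (lambda * Q) = (y' - x') * Q +
      lambda * (((y' - x') / lambda - (1 - E)) * - Q) by field.
  have -> : (y' - x') * (q x' + (c1 + 2) * eta) = (y' - x') * Q +
      (y' - x') * eta by rewrite /Q; ring.
  rewrite lerD2l.
  have E4 : 0 <= (y' - x') / lambda - (1 - E) by rewrite subr_ge0.
  have h7 : - Q <= Qm by have := ler_norm (- Q); rewrite normrN; lra.
  have h8 : ((y' - x') / lambda - (1 - E)) * - Q <=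
      ((y' - x') / lambda) ^+ 2 * Qm.
    apply: le_trans (ler_wpM2l E4 h7) _; apply: ler_wpM2r => //; exact: ltW.
  apply: le_trans (ler_wpM2l (ltW l0) h8) _.
  have -> : lambda * (((y' - x') / lambda) ^+ 2 * Qm) =
      (y' - x') * ((y' - x') / lambda * Qm) by field.
  exact: ler_wpM2l.
have := @increment_le_Rintegral R W q r t ((c1 + 2) * eta) delta cq delta0 rt HW.
move=> /(_ _) H; have {H} : W t - W r <=
    \int[mu]_(z in `[r, t]) q z + 2 * ((c1 + 2) * eta) * (t - r).
  apply: H => x' y'; rewrite !lt_min => /andP[/andP[_ xyq] _]; exact: Hq xyq.
have := Wu t; have := Wu r; move=> /ler_normlP[h1 h2] /ler_normlP[h3 h4] h5.
have : eta * (2 * (c1 + 2) * (t - r) + 4) = e.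
  by rewrite /eta divfK// lt0r_neq0.
rewrite -/(q _); move: h5; rewrite -/q. lra.
Qed.

Lemma integral_solution_of_limit : integral_solution B omega hB LB g u.
Proof.
have [hB_BUC [LB_ge0 _ _] g_lip _] := B_control.
have g_BUC := bounded_lipschitz_BUC g_lip.
have cu := bounded_unif_continuous_continuous (BUC_funP u).
have ch := bounded_unif_continuous_continuous hB_BUC.
have cg := bounded_unif_continuous_continuous g_BUC.
split => // r t x y rt [y0 /= [Br yE]].
set LBw := fun s : R => LB s + s.
have cux : continuous (fun nu => u nu - x).
  by move=> s; apply: cvgB; [exact: cu|exact: cvg_cst].
have cnux : continuous (fun nu => `|u nu - x|).
  by move=> s; apply: cvg_norm; exact: cux.
have cgr : continuous (fun nu => `|g nu - g r|).
  by move=> s; apply: cvg_norm; apply: cvgB; [exact: cg|exact: cvg_cst].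
have chr : continuous (fun nu => `|hB nu - hB r|).
  by move=> s; apply: cvg_norm; apply: cvgB; [exact: ch|exact: cvg_cst].
have cmul (c : R) (q : R -> R) : continuous q -> continuous (fun s => c * q s).
  by move=> cq s; apply: cvgM; [exact: cvg_cst|exact: cq].
have cadd (q q' : R -> R) : continuous q -> continuous q' ->
    continuous (fun s => q s + q' s).
  by move=> cq cq' s; apply: cvgD; [exact: cq|exact: cq'].
pose a n : R := n.+1%:R^-1.
have a0 n : 0 < a n by rewrite invr_gt0.
pose dq n nu := diff_quotient y (u nu - x) (a n).
have cdq n : continuous (dq n).
  apply: cmul => s; apply: cvgB; last exact: cnux.
  by apply: cvg_norm; apply: cvgD; [exact: cux|exact: cvg_cst].
pose N1 nu := norm1 ((hB nu, `|omega| *: g nu) - (hB r, `|omega| *: g r)).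
have N1E : N1 = fun nu => `|hB nu - hB r| + `|omega| * `|g nu - g r|.
  by apply/funext => nu; rewrite /N1 /norm1 /= -scalerBr normrZ normr_id.
have cN1 : continuous N1 by rewrite N1E; apply: cadd => //; exact: cmul.
have int q : continuous q -> mu.-integrable `[r, t] (EFin \o q).
  exact: continuous_integrable_itv.
pose br nu := bracket_plus y (u nu - x).
pose c := LBw `|x| * (\int[mu]_(nu in `[r, t]) N1 nu) +
  `|y| * (\int[mu]_(nu in `[r, t]) `|g nu - g r|).
pose w := \int[mu]_(nu in `[r, t]) (omega * `|u nu - x|).
have Hn n : `|u t - x| - `|u r - x| - (w + c) <= \int[mu]_(nu in `[r, t]) dq n nu.
  have ce : continuous (dist_err r x y0).
    have -> : dist_err r x y0 =
        fun nu => LB `|x| * `|hB nu - hB r| + `|y0| * `|g nu - g r|.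
      by apply/funext => nu; rewrite /dist_err; ring.
    by apply: cadd; exact: cmul.
  have cw : continuous (fun nu => omega * `|u nu - x|) by exact: cmul.
  have cd1 : continuous (fun nu => LBw `|x| * N1 nu) by exact: cmul.
  have cd2 : continuous (fun nu => `|y| * `|g nu - g r|) by exact: cmul.
  have cd := cadd _ _ cd1 cd2.
  have ci1 := cadd _ _ (cadd _ _ (cdq n) cw) ce.
  have ci2 := cadd _ _ (cdq n) (cadd _ _ cw cd).
  rewrite lerBlDr; apply: le_trans (quotient_inequality (a0 n) rt Br) _.
  rewrite -yE.
  apply: (@le_trans _ _ (\int[mu]_(nu in `[r, t]) (dq n nu +
      (omega * `|u nu - x| + (LBw `|x| * N1 nu + `|y| * `|g nu - g r|))))).
    apply: le_Rintegral => //; [exact: int ci1|exact: int ci2|].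
    move=> nu _; rewrite -addrA lerD2l lerD2l N1E /dist_err /LBw.
      (* The element of [B r] is [y0 = y - omega *: x]. The surplus [|omega| * |x|] in its norm is
         paid for by the component [|omega| *: g] of [hBw] together with the summand [s] of
         [LBw]. *)
      have h1 : `|y0| <= `|y| + `|omega| * `|x|.
        have -> : y0 = y - omega *: x by rewrite yE addrK.
        by apply: le_trans (ler_normB _ _) _; rewrite normrZ.
      have := ler_wpM2l (normr_ge0 (g nu - g r)) h1.
      have : 0 <= LB `|x| * (`|omega| * `|g nu - g r|).
        by rewrite !mulr_ge0// LB_ge0.
      have : 0 <= `|x| * `|hB nu - hB r| by rewrite mulr_ge0.
      lra.
  rewrite (RintegralD _ (int _ (cdq n)) (int _ (cadd _ _ cw cd)))//.
  rewrite (RintegralD _ (int _ cw) (int _ cd))//.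
  rewrite (RintegralD _ (int _ cd1) (int _ cd2))//.
  by rewrite (RintegralZl _ _ (int _ cN1))// (RintegralZl _ _ (int _ cgr)).
have cvg_dq nu : (fun n => (dq n nu)%:E) @ \oo --> (br nu)%:E.
  apply: cvg_EFin; first exact: nearW.
  exact: bracket_plus_cvg.
(* The step of the quotient tends to 0; all quotients are dominated by the constant [|y|]. *)
have [br_int _ dq_cvg] : [/\ mu.-integrable `[r, t] (EFin \o br),
    (fun n => \int[mu]_(nu in `[r, t]) `|(dq n nu)%:E - (br nu)%:E|)%E @ \oo --> 0%E
    & (fun n => \int[mu]_(nu in `[r, t]) (dq n nu)%:E)%E @ \oo -->
      (\int[mu]_(nu in `[r, t]) (br nu)%:E)%E].
  apply: (@dominated_convergence _ _ _ mu `[r, t] (measurable_itv _)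
    (fun n => EFin \o dq n) (EFin \o br) (EFin \o fun=> `|y|)).
  - by move=> n; exact: measurable_int (int _ (cdq n)).
  - apply: (@measurable_realfun.emeasurable_fun_cvg _ _ _ _ (fun n => EFin \o dq n)) => [n|nu _].
      exact: measurable_int (int _ (cdq n)).
    exact: cvg_dq.
  - by apply: aeW => nu _; exact: cvg_dq.
  - by apply: int => nu; exact: cvg_cst.
  - apply: aeW => nu n _ /=; rewrite lee_fin ler_norml.
    by rewrite diff_quotient_ge// diff_quotient_le.
rewrite -/N1.
have -> : \int[mu]_(nu in `[r, t]) (bracket_plus y (u nu - x) + omega * `|u nu - x|) =
  \int[mu]_(nu in `[r, t]) br nu + w.
  by rewrite RintegralD//; apply: int; exact: cmul.
have -> (p : R) : p + w + LBw `|x| * \int[mu]_(nu in `[r, t]) N1 nu +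
    `|y| * \int[mu]_(nu in `[r, t]) `|g nu - g r| = p + (w + c) by rewrite /c; ring.
rewrite -lerBlDr; apply: (@cvgr_to_ge _ \oo _ _
  (fun n => \int[mu]_(nu in `[r, t]) dq n nu)); last exact: nearW.
apply: (fine_cvg (f := fun n => \int[mu]_(nu in `[r, t]) (dq n nu)%:E)%E).
by rewrite /Rintegral fineK//; exact: integrable_fin_num br_int.
Qed.

End integral_solutions.

(** * Approximate solutions along a given history *)

Section approximate_solutions.
Variables (R : realType) (X : completeNormedModType R) (d : delay R).
Variables (omega : R) (A : R -> history X d -> set (X * X)).
Variables (g h k : R -> X) (K0 Lg : R) (L1 L2 : R -> R).
Hypothesis A_mdiss : forall (t : R) (phi : history X d), m_dissipative (A t phi).
Hypothesis h_BUC : bounded_unif_continuous h.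
Hypothesis k_BUC : bounded_unif_continuous k.
Hypothesis Lg_ge0 : 0 <= Lg.
Hypothesis g_lip : forall t s, `|g t - g s| <= Lg * `|t - s|.
Hypothesis g_bounded : exists M : R, forall t, `|g t| <= M.
Hypothesis Lg_omega : Lg < - omega.
Hypothesis K0_gt0 : 0 < K0.
Hypothesis K0_omega : K0 < - omega.
Hypothesis L1_ge0 : forall s : R, 0 <= s -> 0 <= L1 s.
Hypothesis L1_mono : forall s t : R, 0 <= s -> s <= t -> L1 s <= L1 t.
Hypothesis L2_ge0 : forall s : R, 0 <= s -> 0 <= L2 s.
Hypothesis L2_mono : forall s t : R, 0 <= s -> s <= t -> L2 s <= L2 t.
Hypothesis A_ctl :
  forall (lambda t1 t2 : R) (phi1 phi2 : history X d) (x1 y1 x2 y2 : X),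
    0 < lambda -> A t1 phi1 (x1, y1) -> A t2 phi2 (x2, y2) ->
    `|x1 - x2| <= `|x1 - x2 - lambda *: (y1 - y2)|
      + lambda * `|h t1 - h t2| * L1 `|x2|
      + lambda * `|g t1 - g t2| * `|y2|
      + lambda * `|k t1 - k t2| * L2 (sup_norm phi2)
      + K0 * lambda * sup_norm (fun s => phi1 s - phi2 s).

Let omega_lt0 : omega < 0.
Proof. by rewrite -oppr_gt0 (lt_trans K0_gt0). Qed.

Lemma control_BUC (lambda t1 t2 : R) (phi1 phi2 : BUC X) (x1 y1 x2 y2 : X)
    (c M : R) : 0 < lambda ->
    A t1 (segment phi1 t1) (x1, y1) -> A t2 (segment phi2 t2) (x2, y2) ->
    (forall s, `|phi1 (t1 + s) - phi2 (t2 + s)| <= c) ->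
    (forall s, `|phi2 s| <= M) ->
  `|x1 - x2| <= `|x1 - x2 - lambda *: (y1 - y2)| +
    lambda * (`|h t1 - h t2| * L1 `|x2| + `|g t1 - g t2| * `|y2| +
              `|k t1 - k t2| * L2 M + K0 * c).
Proof.
move=> l0 A1 A2 Hc HM; apply: le_trans (A_ctl l0 A1 A2) _.
have -> (a b1 b2 b3 b4 : R) : a + lambda * (b1 + b2 + b3 + b4) =
  a + lambda * b1 + lambda * b2 + lambda * b3 + lambda * b4 by ring.
rewrite !mulrA; apply: lerD; [apply: lerD => //|].
  apply: ler_wpM2l; first by rewrite mulr_ge0// ltW.
  apply: L2_mono; last exact: sup_norm_segment_le.
  by apply: (@sup_norm_ge0 _ _ _ _ M) => s; exact: HM.
rewrite (mulrC lambda); apply: ler_wpM2l; first by rewrite mulr_ge0// ltW.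
exact: sup_norm_segmentB_le.
Qed.

Lemma control_shifted (a t1 t2 : R) (phi1 phi2 : BUC X) (x1 y1 x2 y2 : X)
    (c M : R) : 0 < a ->
    A t1 (segment phi1 t1) (x1, y1) -> A t2 (segment phi2 t2) (x2, y2) ->
    (forall s, `|phi1 (t1 + s) - phi2 (t2 + s)| <= c) ->
    (forall s, `|phi2 s| <= M) ->
  (1 - a * omega) * `|x1 - x2| <=
    `|x1 - x2 - a *: ((y1 + omega *: x1) - (y2 + omega *: x2))| +
    a * (`|h t1 - h t2| * L1 `|x2| + `|g t1 - g t2| * `|y2| +
         `|k t1 - k t2| * L2 M + K0 * c).
Proof.
move=> a0 A1 A2 Hc HM; apply: control_shift => // lambda l0.
exact: control_BUC l0 A1 A2 Hc HM.
Qed.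

Lemma approx_solution_graph (lambda : R) (phi v : BUC X) (t : R) :
    approx_solution A omega lambda phi v ->
  A t (segment phi t) (v t, yosida_derivative lambda v t - omega *: v t).
Proof. by move=> /(_ t) [y [Ay ->]]; rewrite addrK. Qed.

Lemma control_solutions (a lambda mu t s : R) (phi psi v w : BUC X) (c M : R) :
    0 < a ->
    approx_solution A omega lambda phi v -> approx_solution A omega mu psi w ->
    (forall r, `|phi (t + r) - psi (s + r)| <= c) ->
    (forall r, `|psi r| <= M) ->
  (1 - a * omega) * `|v t - w s| <=
    `|v t - w s - a *: (yosida_derivative lambda v t - yosida_derivative mu w s)|
    + a * (`|h t - h s| * L1 `|w s| +
         `|g t - g s| * `|yosida_derivative mu w s - omega *: w s| +
         `|k t - k s| * L2 M + K0 * c).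
Proof.
move=> a0 /(@approx_solution_graph _ _ _ t) Av /(@approx_solution_graph _ _ _ s) Aw Hc HM.
by have := control_shifted a0 Av Aw Hc HM; rewrite !subrK.
Qed.

(** The step [a = lambda] leaves only the means, whose distance is bounded by the supremum to be
    estimated. *)
Lemma yosida_derivative_step (lambda t s : R) (v w : BUC X) : 0 < lambda ->
  v t - w s -
    lambda *: (yosida_derivative lambda v t - yosida_derivative lambda w s) =
  yosida_mean lambda v t - yosida_mean lambda w s.
Proof.
move=> l0; rewrite /yosida_derivative -/(yosida_mean lambda v t)
  -/(yosida_mean lambda w s).
by lin_eq R; field; exact: lt0r_neq0.
Qed.

(** At equal times the terms in [h], [g] and [k] vanish. The error left is [lambda * K0 * c], to be
    divided by [- (lambda * omega)]. *)
Lemma approx_solution_dist (lambda : R) (phi psi v w : BUC X) (c : R) :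
    0 < lambda ->
    approx_solution A omega lambda phi v ->
    approx_solution A omega lambda psi w ->
    unif_dist_le phi psi c ->
  unif_dist_le v w (K0 / - omega * c).
Proof.
move=> l0 sv sw Hc; have [M M0 HM] := BUC_bounded psi.
have [B B0 HB] := BUC_dist_bounded v w.
apply: (@sup_selfboundD R R (fun t => `|v t - w t|) B (- (lambda * omega))) => //.
  by have := omega_lt0; rewrite oppr_gt0; nra.
move=> N HN t.
have := control_solutions l0 sv sw (fun r => Hc (t + r)) HM.
rewrite yosida_derivative_step// !subrr !normr0 !mul0r !add0r => H.
apply: le_trans H _; apply: lerD.
  by apply: yosida_mean_dist => // tau _; exact: HN.
rewrite le_eqVlt; apply/orP; left; apply/eqP; field.
by rewrite lt_eqF.
Qed.

Lemma approx_solution_unique (lambda : R) (phi v w : BUC X) : 0 < lambda ->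
    approx_solution A omega lambda phi v ->
    approx_solution A omega lambda phi w ->
  forall t, v t = w t.
Proof.
move=> l0 sv sw t; apply/eqP; rewrite -subr_eq0 -normr_le0.
have := approx_solution_dist (c := 0) l0 sv sw _ t.
by rewrite mulr0; apply => s; rewrite subrr normr0.
Qed.

(** A value exists at each time by m-dissipativity. Comparison with time 0 bounds [x], hence also
    [y = (x - w) / mu]; the g-term then has a coefficient uniform in time, and uniform continuity
    follows. *)
Lemma resolvent_exists (mu : R) (phi w : BUC X) : 0 < mu ->
  exists x : BUC X, forall t, exists y,
    A t (segment phi t) (x t, y) /\ w t = x t - mu *: y.
Proof.
move=> mu0.
have /choice [xy Hxy] : forall t, exists p : X * X,
    A t (segment phi t) p /\ w t = p.1 - mu *: p.2.
  by move=> t; have [x [y Hxy]] := (A_mdiss t (segment phi t)).2 mu mu0 (w t);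
     exists (x, y).
have [M M0 HM] := BUC_bounded phi; have [W W0 HW] := BUC_bounded w.
have [G HG] := g_bounded.
have [H H0 HH] := BUC_bounded (MkBUC h_BUC).
have [K K0' HK] := BUC_bounded (MkBUC k_BUC).
have G0 : 0 <= G by apply: le_trans (HG 0).
have inc t s : `|(xy t).1 - (xy s).1| <= `|w t - w s| + mu *
    (`|h t - h s| * L1 `|(xy s).1| + `|g t - g s| * `|(xy s).2| +
     `|k t - k s| * L2 M + K0 * shift_dist phi t s).
  have [At wt] := Hxy t; have [As ws] := Hxy s.
  rewrite wt ws.
  have -> : (xy t).1 - mu *: (xy t).2 - ((xy s).1 - mu *: (xy s).2) =
    (xy t).1 - (xy s).1 - mu *: ((xy t).2 - (xy s).2) by lin R.
  apply: (@control_BUC _ _ _ phi phi) => //; rewrite -?surjective_pairing//.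
  by move=> r; exact: shift_dist_ge.
have Hxb : exists2 B : R, 0 <= B & forall t, `|(xy t).1| <= B.
  pose B := (W + W) + mu * ((H + H) * L1 `|(xy 0).1| +
    (G + G) * `|(xy 0).2| + (K + K) * L2 M + K0 * (M + M)).
  exists (`|(xy 0).1| + B).
    by rewrite addr_ge0// addr_ge0 ?addr_ge0// mulr_ge0 ?(ltW mu0)//
      ?addr_ge0 ?mulr_ge0 ?addr_ge0 ?L1_ge0 ?L2_ge0// ltW.
  move=> t; have -> : (xy t).1 = (xy 0).1 + ((xy t).1 - (xy 0).1) by lin R.
  apply: le_trans (ler_normD _ _) _; rewrite lerD2l.
  apply: le_trans (inc t 0) _.
  have dd (f : R -> X) N : (forall t, `|f t| <= N) -> `|f t - f 0| <= N + N.
    by move=> fN; apply: le_trans (ler_normB _ _) _; exact: lerD.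
  apply: lerD; first exact: dd.
  apply: ler_wpM2l; first exact: ltW.
  apply: lerD; [apply: lerD; [apply: lerD|]|].
  - by apply: ler_wpM2r; [exact: L1_ge0|exact: (dd h)].
  - by apply: ler_wpM2r; last exact: dd.
  - by apply: ler_wpM2r; [exact: L2_ge0|exact: (dd k)].
  - apply: ler_wpM2l; first exact: ltW.
    apply: (sup_norm_le 0) => s; apply: le_trans (ler_normB _ _) _.
    exact: lerD.
have [B B0 HB] := Hxb.
have Hyb t : `|(xy t).2| <= (B + W) / mu.
  have -> : (xy t).2 = mu^-1 *: ((xy t).1 - w t).
    have [_ ->] := Hxy t; lin_eq R; field; exact: lt0r_neq0.
  rewrite normrZ gtr0_norm ?invr_gt0// mulrC ler_pM2r ?invr_gt0//.
  by apply: le_trans (ler_normB _ _) _; exact: lerD.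
have xBUC : bounded_unif_continuous (fun t => (xy t).1).
  apply: (unif_small_BUC HB).
  apply: (@unif_small_le _ _ (fun t s => `|w t - w s| + mu *
    (L1 B * `|h t - h s| + (B + W) / mu * Lg * `|t - s| +
     L2 M * `|k t - k s| + K0 * shift_dist phi t s))).
    move=> t s; apply: le_trans (inc t s) _; rewrite lerD2l.
    apply: ler_wpM2l; first exact: ltW.
    rewrite lerD2r; apply: lerD; [apply: lerD|]; last by rewrite mulrC.
      by rewrite mulrC; apply: ler_wpM2r => //; apply: L1_mono.
    by rewrite mulrC -mulrA; apply: ler_pM.
  apply: unif_smallD; first exact: BUC_unif_small.
  apply: unif_smallZ; first exact: ltW.
  apply: unif_smallD; [apply: unif_smallD; [apply: unif_smallD|]|].
  - by apply: unif_smallZ (L1_ge0 B0) (BUC_unif_small (MkBUC h_BUC)).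
  - apply: unif_smallZ (@unif_small_dist R).
    by rewrite !mulr_ge0 ?invr_ge0 ?(ltW mu0)// addr_ge0.
  - by apply: unif_smallZ (L2_ge0 M0) (BUC_unif_small (MkBUC k_BUC)).
  - by apply: unif_smallZ (ltW K0_gt0) (shift_dist_unif_small phi).
exists (MkBUC xBUC) => t; exists (xy t).2; have [Axy ->] := Hxy t.
by split => //=; rewrite -surjective_pairing.
Qed.

Lemma approx_solution_exists (lambda : R) (phi : BUC X) : 0 < lambda ->
  exists v : BUC X, approx_solution A omega lambda phi v.
Proof.
(* Collecting [v] in [v - yosida_mean lambda v = lambda *: (y + omega *: v)] and dividing by [p]
   leaves a resolvent equation with parameter [lambda / p]. *)
move=> l0; pose p := 1 - lambda * omega.
have p1 : 1 < p by have := omega_lt0; rewrite /p; nra.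
have p0 : 0 < p by lra.
have mu0 : 0 < lambda / p by rewrite divr_gt0.
have JBUC (v : BUC X) :
    bounded_unif_continuous (fun t => p^-1 *: yosida_mean lambda v t).
  pose Jv := MkBUC (yosida_mean_BUC l0 v).
  have [M M0 HM] := BUC_bounded Jv.
  have pi0 : 0 <= p^-1 by rewrite invr_ge0 ltW.
  apply: (@unif_small_BUC _ _ _ (p^-1 * M)).
    by move=> t; rewrite normrZ ger0_norm// ler_wpM2l// HM.
  apply: unif_small_le (unif_smallZ pi0 (BUC_unif_small Jv)) => t s.
  by rewrite -scalerBr normrZ ger0_norm.
have /choice [T HT] := fun v => resolvent_exists phi (MkBUC (JBUC v)) mu0.
have [| | |v [Tv _]] := @BUC_contraction R X T p^-1 phi.
- by rewrite invr_ge0 ltW.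
- by rewrite invf_lt1.
- move=> u v c uv t.
  have [y [Ay yE]] := HT u t; have [z [Az zE]] := HT v t.
  have := (A_mdiss t (segment phi t)).1 _ _ _ _ _ mu0 Ay Az.
  have -> : T u t - T v t - (lambda / p) *: (y - z) =
    p^-1 *: (yosida_mean lambda u t - yosida_mean lambda v t).
    by rewrite [RHS]scalerBr; have /= -> := yE; have /= -> := zE; lin R.
  move=> H; apply: le_trans H _; rewrite normrZ gtr0_norm ?invr_gt0//.
  rewrite ler_pM2l ?invr_gt0//; exact: yosida_mean_dist.
exists v => t; have [y [Ay /= yE]] := HT v t.
exists y; rewrite -{1}Tv; split => //.
rewrite /yosida_derivative -/(yosida_mean lambda v t).
have -> : yosida_mean lambda v t = p *: (T v t - (lambda / p) *: y).
  by rewrite -yE scalerA divff ?scale1r// lt0r_neq0.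
by rewrite Tv /p; lin_eq R; try ring; field; rewrite !lt0r_neq0.
Qed.

Lemma approx_solution_bounded (M : R) : exists2 C : R, 0 <= C &
  forall (lambda : R) (phi v : BUC X), 0 < lambda -> (forall t, `|phi t| <= M) ->
    approx_solution A omega lambda phi v -> forall t, `|v t| <= C.
Proof.
pose z0 := MkBUC (zero_BUC X).
(* Every solution is compared with this single element, taken at time 0 and the zero history, so the
   bound depends on neither [lambda] nor [phi]. *)
have [x0 [y0 [A0 _]]] := (A_mdiss 0 (segment z0 0)).2 1 ltr01 0.
have [G HG] := g_bounded.
have [H H0 HH] := BUC_bounded (MkBUC h_BUC).
have [K K0' HK] := BUC_bounded (MkBUC k_BUC).
have G0 : 0 <= G by apply: le_trans (HG 0).
have dd (f : R -> X) N t : (forall t, `|f t| <= N) -> `|f t - f 0| <= N + N.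
  by move=> fN; apply: le_trans (ler_normB _ _) _; exact: lerD.
pose F := (H + H) * L1 `|x0| + (G + G) * `|y0| + (K + K) * L2 0 + K0 * M.
have [M0|M0] := ltP M 0.
  exists 0 => // lambda phi v l0 HM; have := HM 0.
  by move=> /(le_trans (normr_ge0 _)); rewrite leNgt M0.
have F0 : 0 <= F.
  by rewrite /F !addr_ge0// !mulr_ge0 ?addr_ge0 ?L1_ge0 ?L2_ge0 ?(ltW K0_gt0).
have om := omega_lt0.
exists (`|x0| + (`|y0 + omega *: x0| + F) / - omega).
  have o0 : 0 <= - omega by rewrite oppr_ge0 ltW.
  by rewrite addr_ge0// divr_ge0// addr_ge0.
move=> lambda phi v l0 HM sv t.
have -> : v t = x0 + (v t - x0) by rewrite addrC subrK.
apply: le_trans (ler_normD _ _) _; rewrite lerD2l; move: t.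
have [B B0 HB] := BUC_bounded v.
apply: (@sup_selfboundD R R (fun t => `|v t - x0|) (B + `|x0|) (- (lambda * omega))).
- by move=> t; apply: le_trans (ler_normB _ _) _; rewrite lerD2r.
- by rewrite oppr_gt0; nra.
move=> N HN t.
have HM0 (s : R) : `|phi (t + s) - z0 (0 + s)| <= M by rewrite subr0.
have Hz (s : R) : `|z0 s| <= 0 by rewrite normr0.
have := control_shifted l0 (approx_solution_graph t sv) A0 HM0 Hz.
rewrite subrK => HC; apply: le_trans HC _.
have -> : N + - (lambda * omega) * ((`|y0 + omega *: x0| + F) / - omega) =
    (N + lambda * `|y0 + omega *: x0|) + lambda * F.
  by field; rewrite lt_eqF.
apply: lerD.
  rewrite /yosida_derivative -/(yosida_mean lambda v t).
  have -> : v t - x0 - lambda *: (lambda^-1 *: (v t - yosida_mean lambda v t) -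
      (y0 + omega *: x0)) =
    (yosida_mean lambda v t - x0) + lambda *: (y0 + omega *: x0).
    by lin_eq R; field; exact: lt0r_neq0.
  apply: le_trans (ler_normD _ _) _; rewrite normrZ gtr0_norm// lerD2r.
  have := @yosida_mean_dist_poly R lambda l0 X v t x0 N 0 0.
  rewrite mulr0 !mul0r !addr0; apply => tau _.
  by rewrite !mul0r !addr0; exact: HN.
apply: ler_wpM2l; first exact: ltW.
rewrite /F; apply: lerD; [apply: lerD; [apply: lerD|]|].
- by apply: ler_wpM2r; [exact: L1_ge0|exact: (dd h)].
- by apply: ler_wpM2r; last exact: dd.
- by apply: ler_wpM2r; [exact: L2_ge0|exact: (dd k)].
- by [].
Qed.

(* The values of A met along the approximate solutions enter the control
   condition only through this product. *)
Definition tame (phi : BUC X) := exists2 Y : R, 0 <= Y &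
  forall (lambda : R) (v : BUC X), 0 < lambda ->
    approx_solution A omega lambda phi v -> forall t s,
    `|g t - g s| * `|yosida_derivative lambda v s - omega *: v s|
      <= Y * `|t - s|.

(* Doubling of variables: [a0 + b (t - s)^2] is a supersolution of the
   inequality satisfied by [|v t - w s|].  The step [a = lambda mu/(lambda + mu)]
   cancels the terms linear in [t - s]. *)
Lemma approx_solution_cauchy (phi : BUC X) : tame phi ->
  forall e : R, 0 < e -> exists2 delta : R, 0 < delta &
    forall (lambda mu : R) (v w : BUC X), 0 < lambda -> lambda < delta ->
      0 < mu -> mu < delta -> approx_solution A omega lambda phi v ->
      approx_solution A omega mu phi w -> unif_dist_le v w e.
Proof.
move=> [Y Y0 HY] e e0; have om := omega_lt0.
have [M M0 HM] := BUC_bounded phi.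
have [B B0 HB] := approx_solution_bounded M.
have rem_small : unif_small (fun t s => L1 B * `|h t - h s| + Y * `|t - s| +
    L2 M * `|k t - k s| + K0 * shift_dist phi t s).
  apply: unif_smallD; [apply: unif_smallD; [apply: unif_smallD|]|].
  - by apply: unif_smallZ (L1_ge0 B0) (BUC_unif_small (MkBUC h_BUC)).
  - by apply: unif_smallZ => //; exact: unif_small_dist.
  - by apply: unif_smallZ (L2_ge0 M0) (BUC_unif_small (MkBUC k_BUC)).
  - by apply: unif_smallZ (ltW K0_gt0) (shift_dist_unif_small phi).
pose o := - omega; have o0 : 0 < o by rewrite oppr_gt0.
have [|C C0 HC] := unif_small_quad rem_small (_ : 0 < e * o / 2).
  by rewrite divr_gt0// mulr_gt0.
exists (e * o ^+ 2 / (8 * (C + 1))).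
  by rewrite divr_gt0// ?mulr_gt0 ?exprn_gt0//; lra.
move=> lambda mu v w l0 ld m0 md sv sw.
(* [o * b = C] absorbs the quadratic part of the remainder. In [o * a0], the term [e * o / 2]
   absorbs the constant part and [2 * b * (lambda + mu)] the second moments of the two means; the
   bound on [lambda] and [mu] keeps the latter small. *)
pose b := C / o; have b0 : 0 <= b by rewrite divr_ge0// ltW.
pose a0 := (e * o / 2 + 2 * b * (lambda + mu)) / o.
have a00 : 0 <= a0.
  have h1 : 0 <= e * o / 2 by rewrite divr_ge0// mulr_ge0// ltW.
  have h2 : 0 <= lambda + mu by rewrite addr_ge0// ltW.
  have h3 : 0 <= 2 * b by rewrite mulr_ge0.
  by rewrite divr_ge0 ?(ltW o0)// addr_ge0// mulr_ge0.
have a0e : a0 <= e.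
  rewrite /a0 /b ler_pdivrMr//.
  have h1 : (C + 1) * (lambda + mu) <= e * o ^+ 2 / 4.
    have -> : e * o ^+ 2 / 4 = (C + 1) * (2 * (e * o ^+ 2 / (8 * (C + 1)))).
      by field; rewrite lt0r_neq0//; lra.
    by rewrite ler_pM2l; lra.
  have h2 : C * (lambda + mu) <= e * o ^+ 2 / 4.
    by apply: le_trans h1; rewrite ler_pM2r ?addr_gt0//; lra.
  have -> : 2 * (C / o) * (lambda + mu) = 2 * (C * (lambda + mu)) / o.
    by field; exact: lt0r_neq0.
  have h3 : 2 * (C * (lambda + mu)) / o <= e * o / 2.
    by rewrite ler_pdivrMr//; lra.
  lra.
pose Phi (t s : R) := a0 + b * (t - s) ^+ 2.
have Phi0 t s : 0 <= Phi t s by rewrite addr_ge0// mulr_ge0// sqr_ge0.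
(* A supremum over pairs of times; the conclusion is read off on the diagonal, where the penalty
   reduces to [a0]. *)
pose D (p : R * R) := `|v p.1 - w p.2| - Phi p.1 p.2.
suff DP p : D p <= 0.
  move=> t; apply: le_trans a0e; have := DP (t, t).
  by rewrite /D /Phi /= subrr expr0n mulr0 addr0 subr_le0.
have [Bv Bv0 HBv] := BUC_bounded v; have [Bw Bw0 HBw] := BUC_bounded w.
have lm0 : 0 < lambda + mu by rewrite addr_gt0.
pose a := lambda * mu / (lambda + mu).
have apos : 0 < a by rewrite divr_gt0// mulr_gt0.
move: p; apply: (@sup_selfboundD R _ D (Bv + Bw) (a * o)).
- move=> p; apply: (@le_trans _ _ `|v p.1 - w p.2|); last first.
    by apply: le_trans (ler_normB _ _) _; exact: lerD.
  by rewrite /D lerBlDr lerDl.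
- exact: mulr_gt0.
move=> N HN [t s]; rewrite mulr0 addr0 /D /=.
have HN' t' s' : `|v t' - w s'| <= N + Phi t' s'.
  by have := HN (t', s'); rewrite /D /= lerBlDr.
have := control_solutions apos sv sw (fun r => shift_dist_ge phi t s r) HM.
have -> : 1 - a * omega = 1 + a * o by rewrite /o mulrN.
set E := (X in _ <= _ + a * X) => H1.
have HE : E <= e * o / 2 + C * (t - s) ^+ 2.
  apply: le_trans (HC t s); rewrite /E; apply: lerD => //.
  apply: lerD; [apply: lerD|]; last by rewrite mulrC.
    rewrite mulrC; apply: ler_wpM2r => //; apply: L1_mono => //.
    exact: (HB _ _ _ m0 HM sw).
  exact: (HY _ _ m0 sw).
(* Expanding the penalty in the delay [tau] gives linear terms of opposite signs for the two means;
   the weights used below make them cancel. *)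
have Hw : `|yosida_mean mu w s - v t| <=
    N + a0 + b * (t - s) ^+ 2 + 2 * b * (t - s) * mu + 2 * b * mu ^+ 2.
  apply: yosida_mean_dist_poly => // tau _; rewrite distrC.
  by apply: le_trans (HN' _ _) _; rewrite /Phi; lra.
have Hv : `|yosida_mean lambda v t - w s| <=
    N + a0 + b * (t - s) ^+ 2 + - (2 * b * (t - s)) * lambda +
    2 * b * lambda ^+ 2.
  apply: yosida_mean_dist_poly => // tau _.
  by apply: le_trans (HN' _ _) _; rewrite /Phi; lra.
have ln := lt0r_neq0 l0; have mn := lt0r_neq0 m0; have lmn := lt0r_neq0 lm0.
have : `|v t - w s - a *: (yosida_derivative lambda v t - yosida_derivative mu w s)|
    <= N + Phi t s + 2 * a * b * (lambda + mu).
  rewrite /yosida_derivative -/(yosida_mean lambda v t) -/(yosida_mean mu w s).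
  have -> : v t - w s - a *: (lambda^-1 *: (v t - yosida_mean lambda v t) -
      mu^-1 *: (w s - yosida_mean mu w s)) =
    (mu / (lambda + mu)) *: (yosida_mean lambda v t - w s) -
    (lambda / (lambda + mu)) *: (yosida_mean mu w s - v t).
    by rewrite /a; lin_eq R; field; rewrite ?ln ?mn ?lmn.
  apply: le_trans (ler_normB _ _) _.
  have c1 : 0 <= mu / (lambda + mu) by rewrite divr_ge0 ?ltW.
  have c2 : 0 <= lambda / (lambda + mu) by rewrite divr_ge0 ?ltW.
  rewrite normrZ (ger0_norm c1) normrZ (ger0_norm c2).
  apply: le_trans (lerD (ler_wpM2l c1 Hv) (ler_wpM2l c2 Hw)) _.
  by rewrite le_eqVlt; apply/orP; left; apply/eqP; rewrite /Phi /a; field.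
move=> H2.
have aE := ler_wpM2l (ltW apos) HE.
have : a * o * Phi t s = a * (e * o / 2 + 2 * b * (lambda + mu)) +
    a * (C * (t - s) ^+ 2).
  by rewrite /Phi /a0 /b; field; exact: lt0r_neq0.
move: H1 H2 aE; lra.
Qed.

(* Control of the difference quotients by the derivative and conversely:
   [Lg < - omega] closes the loop. *)
Lemma tame_lipschitz (phi : BUC X) :
    (exists2 L : R, 0 <= L & L.-lipschitz h) ->
    (exists2 L : R, 0 <= L & L.-lipschitz k) ->
    (exists2 L : R, 0 <= L & L.-lipschitz phi) ->
  tame phi.
Proof.
move=> [Lh Lh0 /klipschitzP h_lip] [Lk Lk0 /klipschitzP k_lip].
move=> [Lp Lp0 /klipschitzP phi_lip].
have [M M0 HM] := BUC_bounded phi.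
have [C C0 HC] := approx_solution_bounded M.
have om := omega_lt0; have Lgo := Lg_omega.
pose o := - omega; have o0 : 0 < o by rewrite oppr_gt0.
pose b := (Lg * (o * C) + Lh * L1 C + Lk * L2 M + K0 * Lp) / o.
have th1 : Lg / o < 1 by rewrite ltr_pdivrMr ?mul1r.
have b0 : 0 <= b.
  have h1 : 0 <= o * C by rewrite mulr_ge0// ltW.
  by rewrite divr_ge0 ?(ltW o0)// !addr_ge0// mulr_ge0 ?L1_ge0 ?L2_ge0// ltW.
(* The fixed point of [N -> Lg / o * N + b], the improvement of a bound [N] on the derivative; [b]
   collects the remaining Lipschitz errors. *)
pose Y0 := b / (1 - Lg / o).
have Y00 : 0 <= Y0 by rewrite divr_ge0// subr_ge0 ltW.
suff HY lambda (v : BUC X) : 0 < lambda -> approx_solution A omega lambda phi v ->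
    forall s, `|yosida_derivative lambda v s| <= Y0.
  have YC0 : 0 <= Y0 + o * C by rewrite addr_ge0// mulr_ge0// ltW.
  exists (Lg * (Y0 + o * C)) => [|lambda v l0 sv t s].
    by rewrite mulr_ge0// (le_trans Lg_ge0).
  rewrite mulrAC; apply: ler_pM => //.
  apply: le_trans (ler_normB _ _) _; apply: lerD; first exact: HY.
  rewrite normrZ ltr0_norm// ler_pM2l//; exact: HC sv _.
move=> l0 sv.
have [B B0 HB] := BUC_bounded v.
have dE s : yosida_derivative lambda v s =
  lambda^-1 *: (v s - yosida_mean lambda v s) by [].
have dB s : `|yosida_derivative lambda v s| <= lambda^-1 * (B + B).
  rewrite dE normrZ gtr0_norm ?invr_gt0// ler_pM2l ?invr_gt0//.
  apply: le_trans (ler_normB _ _) _; apply: lerD => //.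
  have := @yosida_mean_dist_poly R lambda l0 X v s 0 B 0 0.
  rewrite mulr0 !mul0r !addr0 subr0; apply => tau _.
  by rewrite !mul0r !addr0 subr0.
apply: (sup_selfbound dB th1) => N HN s.
pose P := Lg / o * N + b.
(* A bound [N] on the derivative bounds the values of [A]; comparing the solution at [t + r] and at
   [t] then bounds its difference quotients by [P]. *)
have v_lip r t : `|v (t + r) - v t| <= P * `|r|.
  move: t; apply: (@sup_selfboundD R R (fun t => `|v (t + r) - v t|) (B + B)
    (lambda * o)).
  - by move=> t; apply: le_trans (ler_normB _ _) _; exact: lerD.
  - exact: mulr_gt0.
  move=> Q HQ t.
  have Hc (q : R) : `|phi (t + r + q) - phi (t + q)| <= Lp * `|r|.
    by apply: le_trans (phi_lip _ _) _; rewrite opprD addrACA subrr addr0 addrAC subrr add0r.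
  have := control_solutions l0 sv sv Hc HM.
  rewrite yosida_derivative_step// -mulrN -/o => H1; apply: le_trans H1 _.
  apply: lerD.
    apply: yosida_mean_dist => // tau _.
    by rewrite addrAC; exact: HQ.
  have -> : lambda * o * (P * `|r|) = lambda * (Lh * `|r| * L1 C +
    Lg * `|r| * (N + o * C) + Lk * `|r| * L2 M + K0 * (Lp * `|r|)).
    by rewrite /P /b; field; exact: lt0r_neq0.
  have rE : t + r - t = r by rewrite addrAC subrr add0r.
  apply: ler_wpM2l; first exact: ltW.
  apply: lerD => //; apply: lerD; [apply: lerD|].
  - have h1 := h_lip (t + r) t; rewrite rE in h1.
    by apply: ler_pM => //; [exact: L1_ge0 | apply: L1_mono => //; exact: HC sv _].
  - have h1 := g_lip (t + r) t; rewrite rE in h1; apply: ler_pM => //.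
    apply: le_trans (ler_normB _ _) _; apply: lerD => //.
    rewrite normrZ ltr0_norm// ler_pM2l//; exact: HC sv _.
  - have h1 := k_lip (t + r) t; rewrite rE in h1.
    by apply: ler_wpM2r => //; exact: L2_ge0.
(* Conversely, a Lipschitz constant [P] bounds the derivative by [P]: the first moment [lambda] of
   the weight cancels the factor [lambda^-1]. *)
rewrite dE -normrN -scalerN opprB normrZ gtr0_norm ?invr_gt0// ler_pdivrMl//.
have := @yosida_mean_dist_poly R lambda l0 X v s (v s) 0 P 0.
rewrite mulr0 mul0r add0r addr0 mulrC; apply => tau tau0.
rewrite mul0r add0r addr0; apply: le_trans (v_lip _ _) _.
by rewrite normrN ger0_norm.
Qed.

(** * The limits in [lambda] and in [n] *)

Section limits.
Hypothesis tame_dense : forall (phi : BUC X) (e : R), 0 < e ->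
  exists2 psi : BUC X, tame psi & unif_dist_le phi psi e.

Let kappa := K0 / - omega.

Let kappa_ge0 : 0 <= kappa.
Proof. by rewrite divr_ge0 ?(ltW K0_gt0)// oppr_ge0 ltW. Qed.

Let kappa_lt1 : kappa < 1.
Proof. by rewrite ltr_pdivrMr ?mul1r// oppr_gt0. Qed.

Lemma approx_solution_cauchy_dense (phi : BUC X) (e : R) : 0 < e ->
  exists2 delta : R, 0 < delta &
    forall (lambda mu : R) (v w : BUC X), 0 < lambda -> lambda < delta ->
      0 < mu -> mu < delta -> approx_solution A omega lambda phi v ->
      approx_solution A omega mu phi w -> unif_dist_le v w e.
Proof.
move=> e0; have e30 : 0 < e / 3 by lra.
have [psi tpsi pp] := tame_dense phi e30.
have [delta d0 Hd] := approx_solution_cauchy tpsi e30.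
exists delta => // lambda mu v w l0 ld m0 md sv sw t.
have [v' sv'] := approx_solution_exists psi l0.
have [w' sw'] := approx_solution_exists psi m0.
have h1 := approx_solution_dist l0 sv sv' pp t.
have h2 := approx_solution_dist m0 sw sw' pp t.
have h3 := Hd _ _ _ _ l0 ld m0 md sv' sw' t.
have h4 : K0 / - omega * (e / 3) <= e / 3.
  by rewrite ler_piMl ?(ltW e30)// ltW.
have -> : v t - w t = (v t - v' t) + (v' t - w' t) - (w t - w' t) by lin R.
apply: le_trans (ler_normB _ _) _.
by have := ler_normD (v t - v' t) (v' t - w' t); lra.
Qed.

Lemma solution_operator : exists sol : R -> BUC X -> BUC X,
  forall (lambda : R) (phi : BUC X), 0 < lambda ->
    approx_solution A omega lambda phi (sol lambda phi).
Proof.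
have /choice [sol Hsol] : forall p : R * BUC X, exists v : BUC X,
    0 < p.1 -> approx_solution A omega p.1 p.2 v.
  move=> [lambda phi]; have [l0|_] := ltP 0 lambda; last by exists phi.
  by have [v] := approx_solution_exists phi l0; exists v.
by exists (fun lambda phi => sol (lambda, phi)) => lambda phi; exact: Hsol (_, _).
Qed.

Lemma limit_solution : exists S : BUC X -> BUC X,
  (forall phi (e : R), 0 < e -> exists2 delta : R, 0 < delta &
     forall (lambda : R) (v : BUC X), 0 < lambda -> lambda < delta ->
     approx_solution A omega lambda phi v -> unif_dist_le v (S phi) e) /\
  (forall (phi psi : BUC X) (c : R), unif_dist_le phi psi c ->
     unif_dist_le (S phi) (S psi) (kappa * c)).
Proof.
have [sol Hsol] := solution_operator.
have /choice [S HS] : forall phi, exists u : BUC X, forall e : R, 0 < e ->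
    exists2 delta : R, 0 < delta & forall lambda : R, 0 < lambda ->
    lambda < delta -> unif_dist_le (sol lambda phi) u e.
  move=> phi; apply: BUC_cauchy_lim0 => e e0.
  have [delta d0 Hd] := approx_solution_cauchy_dense phi e0.
  exists delta => // l m l0 ld m0 md.
  by apply: (Hd l m) => //; exact: Hsol.
have SP phi (e : R) : 0 < e -> exists2 delta : R, 0 < delta &
     forall (lambda : R) (v : BUC X), 0 < lambda -> lambda < delta ->
     approx_solution A omega lambda phi v -> unif_dist_le v (S phi) e.
  move=> e0; have [delta d0 Hd] := HS phi e e0.
  exists delta => // lambda v l0 ld sv t.
  rewrite (approx_solution_unique l0 sv (Hsol lambda phi l0)); exact: Hd.
exists S; split => // phi psi c Hc t.
apply/ler_addgt0Pr => e e0; have e20 : 0 < e / 2 by lra.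
have [d1 d10 H1] := SP phi _ e20; have [d2 d20 H2] := SP psi _ e20.
pose lambda := Num.min d1 d2 / 2.
have m0 : 0 < Num.min d1 d2 by rewrite lt_min d10.
have l0 : 0 < lambda by rewrite divr_gt0.
have lm : lambda < Num.min d1 d2 by rewrite /lambda; lra.
have [v sv] := approx_solution_exists phi l0.
have [w sw] := approx_solution_exists psi l0.
have [ld1 ld2] : lambda < d1 /\ lambda < d2.
  by apply/andP; rewrite -lt_min.
have h1 := H1 _ _ l0 ld1 sv t; have h2 := H2 _ _ l0 ld2 sw t.
have h3 := approx_solution_dist l0 sv sw Hc t.
have -> : S phi t - S psi t = (v t - w t) - (v t - S phi t) + (w t - S psi t).
  by lin R.
apply: le_trans (ler_normD _ _) _.
by have := ler_normB (v t - w t) (v t - S phi t); rewrite /kappa; lra.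
Qed.

Lemma recursion_exists (psi : BUC X) :
  exists uu : nat -> R -> BUC X, recursion A omega psi uu.
Proof.
have [sol Hsol] := solution_operator.
exists (fun n lambda => iter n (sol lambda) psi).
by move=> lambda l0; split=> [|n n1]; exact: Hsol.
Qed.

Lemma recursion_unique (psi : BUC X) (uu uu' : nat -> R -> BUC X) :
    recursion A omega psi uu -> recursion A omega psi uu' ->
  forall (n : nat) (lambda : R), (1 <= n)%N -> 0 < lambda ->
  forall t : R, uu n lambda t = uu' n lambda t.
Proof.
move=> ru ru' [//|n] lambda _ l0; have [u1 un] := ru _ l0.
have [u1' un'] := ru' _ l0.
elim: n => [|n IH]; first exact: approx_solution_unique u1 u1'.
move=> t; apply/eqP; rewrite -subr_eq0 -normr_le0.
have := approx_solution_dist (c := 0) l0 (un n.+1 isT) (un' n.+1 isT) _ t.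
by rewrite mulr0; apply => s; rewrite IH subrr normr0.
Qed.

(** Because the dependence on the history is uniform in [lambda], the limit in [lambda] passes
    through each stage of the recursion and the inner limits are the iterates of [S]. The last
    conjunct restates [S u = u] through approximate solutions along [u], the input of the integral
    inequality. *)
Lemma double_limit : exists u : BUC X,
  (forall (psi : BUC X) (uu : nat -> R -> BUC X), recursion A omega psi uu ->
     uniform_double_limit uu u /\
     forall u', uniform_double_limit uu u' -> forall t, u' t = u t) /\
  (forall e : R, 0 < e -> exists2 delta : R, 0 < delta &
     forall (lambda : R) (v : BUC X), 0 < lambda -> lambda < delta ->
     approx_solution A omega lambda u v -> unif_dist_le v u e).
Proof.
have [S [SP Sc]] := limit_solution.
have [u [Su uP]] := BUC_contraction (MkBUC (zero_BUC X)) kappa_ge0 kappa_lt1 Sc.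
exists u; split; last first.
  move=> e e0; have [delta d0 Hd] := SP u e e0.
  exists delta => // lambda v l0 ld sv t; rewrite -[u t]Su.
  exact: Hd sv t.
move=> psi uu ru.
have near0 (delta : R) : 0 < delta -> \forall l \near 0^'+, 0 < l /\ l < delta.
  move=> d0; near=> l; split; near: l; first exact: nbhs_right_gt.
  exact: nbhs_right_lt.
have Hn n e : 0 < e -> exists2 delta : R, 0 < delta & forall lambda : R,
    0 < lambda -> lambda < delta ->
    unif_dist_le (uu n.+1 lambda) (iter n.+1 S psi) e.
  elim: n e => [|n IH] e e0.
    have [delta d0 Hd] := SP psi e e0; exists delta => // lambda l0 ld.
    exact: (Hd _ _ l0 ld (ru _ l0).1).
  have e20 : 0 < e / 2 by lra.
  have [d1 d10 H1] := IH _ e20.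
  have [d2 d20 H2] := SP (iter n.+1 S psi) _ e20.
  exists (Num.min d1 d2); first by rewrite lt_min d10.
  move=> lambda l0; rewrite lt_min => /andP[ld1 ld2] t.
  (* [w] follows the limit history exactly: its distance to [uu n.+2 lambda] comes from the
     histories, its distance to the next iterate from the limit in [lambda]. *)
  have [w sw] := approx_solution_exists (iter n.+1 S psi) l0.
  have [_ /(_ n.+1 isT) su] := ru _ l0.
  have h1 := approx_solution_dist l0 su sw (H1 _ l0 ld1) t.
  have h2 := H2 _ _ l0 ld2 sw t.
  have h4 : K0 / - omega * (e / 2) <= e / 2.
    by rewrite ler_piMl ?(ltW e20)// ltW.
  have -> : uu n.+2 lambda t - iter n.+2 S psi t =
    (uu n.+2 lambda t - w t) + (w t - S (iter n.+1 S psi) t).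
    by rewrite /=; lin R.
  by apply: le_trans (ler_normD _ _) _; lra.
have lim1 n : (1 <= n)%N ->
    {uniform, (fun lambda : R => uu n lambda : R -> X) @ 0^'+ -->
      (iter n S psi : R -> X)}.
  case: n => // n _; apply/uniform_cvgP => e e0.
  have [delta d0 Hd] := Hn n e e0.
  by apply: filterS (near0 _ d0) => l [l0 ld]; exact: Hd.
have lim2 : {uniform, (fun n => iter n S psi : R -> X) @ \oo --> (u : R -> X)}.
  apply/uniform_cvgP => e e0; have [N HN] := uP psi e e0.
  by exists N => // n /= Nn; exact: HN.
split; first by exists (fun n => iter n S psi).
move=> u' [un [unl unu']].
apply: (@uniform_cvg_unique _ _ _ \oo _ un) => //.
apply/uniform_cvgP => e e0; move/uniform_cvgP : lim2 => /(_ e e0).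
move=> H; near=> n.
have n1 : (1 <= n)%N by near: n; exists 1%N.
move=> t; rewrite (uniform_cvg_unique (unl n n1) (lim1 n n1)).
by move: t; near: n.
Unshelve. all: end_near. Qed.

End limits.

Lemma frozen_operator_control (u : BUC X) :
    control_modulus L1 -> bounded_lipschitz g ->
  exists (hB : R -> bounded_function (option (option R)) X) (LB : R -> R),
    operator_control (fun t => A t (segment u t)) hB LB g.
Proof.
move=> [_ L1_cont _] gP.
have [M M0 HM] := BUC_bounded u.
have [H H0 HH] := BUC_bounded (MkBUC h_BUC).
have [K K0' HK] := BUC_bounded (MkBUC k_BUC).
pose f t (o : option (option R)) := match o with
  | None => h t | Some None => k t | Some (Some s) => u (t + s) end.
have f_le t o : `|f t o| <= H + K + M.
  have h1 : `|h t| <= H by exact: HH.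
  have h2 : `|k t| <= K by exact: HK.
  by case: o => [[s|]|] /=; first have := HM (t + s); lra.
have fb t : f t \in @bounded_pred (option (option R)) R X.
  by apply/asboolP; exists (H + K + M).
pose hB t := BoundedFunction (fb t).
have hBE t s : `|hB t - hB s| = sup_norm (hB t - hB s) by [].
have dh t s : `|h t - h s| <= `|hB t - hB s|.
  exact: (le_bounded_norm (hB t - hB s) None).
have dk t s : `|k t - k s| <= `|hB t - hB s|.
  exact: (le_bounded_norm (hB t - hB s) (Some None)).
have du t s : shift_dist u t s <= `|hB t - hB s|.
  apply: (sup_norm_le 0) => r.
  exact: (le_bounded_norm (hB t - hB s) (Some (Some r))).
have L2M := L2_ge0 M0; have K0g := K0_gt0.
(* Each of the increments in [h], [k] and the translates of [u] is a coordinate of that of [hB]. The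
   last two have coefficients independent of [x2], which become the constants added to [L1]. *)
exists hB, (fun s => L1 s + (L2 M + K0)); split => //.
- apply: (@unif_small_BUC _ _ _ (H + K + M)).
    move=> t; apply: bounded_norm_le => [|o]; last exact: f_le.
    by rewrite !addr_ge0.
  apply: (@unif_small_le _ _ (fun t s =>
      `|h t - h s| + `|k t - k s| + shift_dist u t s)).
    move=> t s; rewrite hBE.
    have h0 := normr_ge0 (h t - h s); have k0 := normr_ge0 (k t - k s).
    have s0 : 0 <= shift_dist u t s.
      exact: le_trans (normr_ge0 _) (shift_dist_ge u t s 0).
    apply: bounded_norm_le => [|o]; first by rewrite !addr_ge0.
    case: o => [[r|]|] /=.
    + by have := shift_dist_ge u t s r; lra.
    + by lra.
    + by lra.
  apply: unif_smallD; last exact: shift_dist_unif_small.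
  by apply: unif_smallD; [exact: (BUC_unif_small (MkBUC h_BUC))|
    exact: (BUC_unif_small (MkBUC k_BUC))].
- split=> [s s0|s|s t s0 st].
  + by rewrite !addr_ge0 ?L1_ge0 ?(ltW K0g).
  + by apply: cvgD; [exact: L1_cont|exact: cvg_cst].
  + by rewrite lerD2r; exact: L1_mono.
- move=> lambda t1 t2 x1 y1 x2 y2 l0 A1 A2.
  apply: le_trans (control_BUC l0 A1 A2 (shift_dist_ge u t1 t2) HM) _.
  rewrite -!addrA lerD2l -!(mulrA lambda) -mulrDr ler_pM2l//.
  have := ler_wpM2r (L1_ge0 (normr_ge0 x2)) (dh t1 t2).
  have := ler_wpM2r L2M (dk t1 t2).
  have := ler_wpM2l (ltW K0g) (du t1 t2).
  lra.
Qed.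

Lemma approximation_scheme :
    control_modulus L1 -> bounded_lipschitz g ->
    (forall (phi : BUC X) (e : R), 0 < e ->
       exists2 psi : BUC X, tame psi & unif_dist_le phi psi e) ->
  (forall psi : BUC X,
     (exists uu : nat -> R -> BUC X, recursion A omega psi uu) /\
     (forall uu uu' : nat -> R -> BUC X,
        recursion A omega psi uu -> recursion A omega psi uu' ->
        forall (n : nat) (lambda : R), (1 <= n)%N -> 0 < lambda ->
        forall t : R, uu n lambda t = uu' n lambda t)) /\
  (forall (psi : BUC X) (uu : nat -> R -> BUC X), recursion A omega psi uu ->
     exists u : BUC X,
       [/\ uniform_double_limit uu u,
           (forall (psi' : BUC X) (uu' : nat -> R -> BUC X) (u' : R -> X),
              recursion A omega psi' uu' -> uniform_double_limit uu' u' ->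
              forall t : R, u' t = u t) &
           exists (Z : completeNormedModType R) (hB : R -> Z) (LB : R -> R),
             integral_solution (fun t => A t (segment u t)) omega
               hB LB g u]).
Proof.
move=> L1P gP tame_dense; split.
  by move=> psi; split; [exact: recursion_exists|exact: recursion_unique].
move=> psi uu ru; have [u [u_lim u_fix]] := double_limit tame_dense.
exists u; split; first by have [] := u_lim _ _ ru.
  by move=> psi' uu' u' /u_lim[_ H]; exact: H.
have [hB [LB B_control]] := frozen_operator_control u L1P gP.
exists (bounded_function (option (option R)) X), hB, LB.
apply: integral_solution_of_limit => // e e0.
have [delta d0 Hd] := u_fix e e0; exists delta => // lambda l0 ld.
have [v sv] := approx_solution_exists u l0.
by exists v; [move=> t; exact: approx_solution_graph | exact: Hd sv].
Qed.

End approximate_solutions.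

(* g is the Lipschitz control function; it is 0 in the uniformly continuous
   case.  The first conjunct says that the recursion defines its double
   sequence. *)
Theorem theorem3p3 (R : realType) (X : completeNormedModType R)
    (d : delay R) (omega : R) (A : R -> history X d -> set (X * X))
    (g h k : R -> X) (K0 : R) (L1 L2 : R -> R)
    (A_mdiss : forall (t : R) (phi : history X d), m_dissipative (A t phi))
    (A_control :
      [/\ unif_control A h k K0 L1 L2, K0 < - omega & g = (fun=> 0)] \/
      (lipschitz_control A g h k K0 L1 L2 /\
       Num.max K0 (lipschitz_constant g) < - omega)) :
  (forall psi : BUC X,
     (exists uu : nat -> R -> BUC X, recursion A omega psi uu) /\
     (forall uu uu' : nat -> R -> BUC X,
        recursion A omega psi uu -> recursion A omega psi uu' ->
        forall (n : nat) (lambda : R), (1 <= n)%N -> 0 < lambda ->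
        forall t : R, uu n lambda t = uu' n lambda t)) /\
  (forall (psi : BUC X) (uu : nat -> R -> BUC X), recursion A omega psi uu ->
     exists u : BUC X,
       [/\ uniform_double_limit uu u,
           (forall (psi' : BUC X) (uu' : nat -> R -> BUC X) (u' : R -> X),
              recursion A omega psi' uu' -> uniform_double_limit uu' u' ->
              forall t : R, u' t = u t) &
           exists (Z : completeNormedModType R) (hB : R -> Z) (LB : R -> R),
             integral_solution (fun t => A t (segment u t)) omega
               hB LB g u]).
Proof.
case: A_control => [[[[hP kP] K0_gt0 [L1P L2P] ctl] K0_omega g0]|].
  have [L1_ge0 _ L1_mono] := L1P; have [L2_ge0 _ L2_mono] := L2P.
  have omega_gt0 : 0 < - omega by exact: lt_trans K0_omega.
  have gE t s : `|g t - g s| = 0 by rewrite g0 subrr normr0.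
  (* With [g = 0] and [Lg = 0] the g-term vanishes, so every history is tame and density is
     trivial. *)
  apply: (@approximation_scheme _ _ _ _ _ g h k K0 0 L1 L2) => //.
  - by move=> t s; rewrite gE mul0r.
  - by exists 0 => t; rewrite g0 normr0.
  - move=> lambda t1 t2 phi1 phi2 x1 y1 x2 y2 l0 A1 A2.
    by rewrite gE mulr0 mul0r addr0; exact: ctl.
  - split; rewrite g0.
      exists 0; split; first exact: num_real.
      by move=> M M0 t _; rewrite normr0 ltW.
    exists 0; split; first exact: num_real.
    by move=> M /ltW M0 [t s] _; rewrite /= subrr normr0 mulr_ge0.
  - move=> phi e e0; exists phi; last by move=> t; rewrite subrr normr0 ltW.
    by exists 0 => // lambda v l0 sv t s; rewrite gE !mul0r.
move=> [[[gP hP kP] K0_gt0 [L1P L2P] ctl]].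
rewrite gt_max => /andP[K0_omega Lg_omega].
have [L1_ge0 _ L1_mono] := L1P; have [L2_ge0 _ L2_mono] := L2P.
have [_ /lipschitzP h_lip] := hP; have [_ /lipschitzP k_lip] := kP.
(* [lipschitz_constant] is an infimum; the strict inequality provides an admissible constant that is
   still below [- omega]. *)
have [Lg [Lg0 /klipschitzP g_lip] Lgo] : exists2 L : R,
    0 <= L /\ L.-lipschitz g & L < - omega.
  have [_ /lipschitzP[L L0 Lg]] := gP.
  have [|L' [L'0 HL'] L'o] := inf_lt _ Lg_omega; first by exists L.
  by exists L'.
have hB := bounded_lipschitz_BUC hP; have kB := bounded_lipschitz_BUC kP.
have [Mg _ HMg] := BUC_bounded (MkBUC (bounded_lipschitz_BUC gP)).
apply: (@approximation_scheme _ _ _ _ _ g h k K0 Lg L1 L2) => //.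
  by exists Mg.
move=> phi e e0; have [psi pp psi_lip] := BUC_lipschitz_dense phi e0.
exists psi => //.
apply: (tame_lipschitz (h := h) (k := k) (K0 := K0) (Lg := Lg) (L1 := L1)
  (L2 := L2)) => //.
by exists Mg.
Qed.
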